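(* Let $G$ be a commutative group and let $h\colon R\to S$ be a morphism of $G$-graded commutative rings. The following statements are equivalent: (i) the functor $h^*\colon\mathrm{Mod}^G(R)\to\mathrm{Mod}^G(S)$ has a left adjoint; (ii) the functor $\widetilde h\colon\mathrm{Mod}^G(R)\to\mathrm{Mod}^G(S)$ has a right adjoint; (iii) the $G$-graded $R$-module $h_*(S)$ is projective and of finite type.
   Context: All groups and rings are commutative (rings unital). $\mathrm{Mod}^G(R)$ is the category of $G$-graded $R$-modules with degree-preserving $R$-linear maps; $M(g)$ is the shift, $M(g)_{g'}=M_{g+g'}$. The tensor product $M\otimes_RN$ is graded with $x\otimes y$ in degree $\deg x+\deg y$. $\mathrm{Hom}^G_R(M,N)=\bigoplus_{g\in G}\mathrm{Hom}_{\mathrm{Mod}^G(R)}(M,N(g))$, a $G$-graded $R$-module. $h_*\colon\mathrm{Mod}^G(S)\to\mathrm{Mod}^G(R)$ is restriction of scalars along $h$. $h^*(M)=S\otimes_RM$ (the graded tensor product $h_*(S)\otimes_RM$ with $s(t\otimes x)=(st)\otimes x$). $\widetilde h(M)=\mathrm{Hom}^G_R(h_*(S),M)$ with $S$-action $(su)(t)=u(st)$. A $G$-graded $R$-module $M$ is of finite type if there is an epimorphism $L\to M$ in $\mathrm{Mod}^G(R)$ with $L\cong\bigoplus_{i\in I}R(g_i)$ for a finite family $(g_i)_{i\in I}$ in $G$; it is projective if $\mathrm{Hom}_{\mathrm{Mod}^G(R)}(M,\bullet)$ is exact. *)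

(* Defs.v *)
From HB Require Import structures.
From mathcomp Require Import all_boot all_algebra.
From mathcomp Require Import boolp classical_sets functions.

Set Implicit Arguments.
Unset Strict Implicit.
Unset Printing Implicit Defensive.

Import GRing.Theory.
Local Open Scope ring_scope.

Record category := Category {
  obj :> Type;
  hom : obj -> obj -> Type;
  idm : forall X, hom X X;
  compm : forall X Y Z, hom Y Z -> hom X Y -> hom X Z;
  compm1 : forall X Y (f : hom X Y), compm f (idm X) = f;
  comp1m : forall X Y (f : hom X Y), compm (idm Y) f = f;
  compmA : forall X Y Z T (f : hom Z T) (g : hom Y Z) (k : hom X Y),
    compm f (compm g k) = compm (compm f g) k }.

Arguments hom {c} X Y.
Arguments idm {c} X.
Arguments compm {c X Y Z} f g.

Definition epi (C : category) (X Y : C) (f : hom X Y) : Prop :=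
  forall (Z : C) (a b : hom Y Z), compm a f = compm b f -> a = b.

Definition isomorphic (C : category) (X Y : C) : Prop :=
  exists (f : hom X Y) (g : hom Y X), compm g f = idm X /\ compm f g = idm Y.

Record functor (C D : category) := Functor {
  fobj :> C -> D;
  fmap : forall X Y : C, hom X Y -> hom (fobj X) (fobj Y);
  fmap1 : forall X : C, fmap (idm X) = idm (fobj X);
  fmapM : forall (X Y Z : C) (f : hom Y Z) (g : hom X Y),
    fmap (compm f g) = compm (fmap f) (fmap g) }.

Arguments fmap {C D} _ {X Y} _.

(* F is left adjoint to U. *)
Record adjunction (C D : category) (F : functor C D) (U : functor D C) :=
  Adjunction {
    adj : forall (X : C) (Y : D), hom (F X) Y -> hom X (U Y);
    adj_bij : forall (X : C) (Y : D), bijective (@adj X Y);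
    adj_nat : forall (X X' : C) (Y Y' : D)
        (f : hom X' X) (g : hom Y Y') (u : hom (F X) Y),
      adj (compm g (compm u (fmap F f))) =
      compm (fmap U g) (compm (adj u) f) }.

Definition has_left_adjoint (C D : category) (U : functor D C) : Prop :=
  exists F : functor C D, inhabited (adjunction F U).

Definition has_right_adjoint (C D : category) (F : functor C D) : Prop :=
  exists U : functor D C, inhabited (adjunction F U).

(* Gradings. The homogeneous components are subgroups of the underlying      *)
(* group, which is required to be their internal direct sum.                 *)

Section Grading.
Variables (G V : zmodType).
Implicit Types (c : G -> set V) (x y : V).

Definition hsum c : set V :=
  [set x | exists (s : seq G) (f : G -> V),
     [/\ uniq s, forall g, c g (f g) & x = \sum_(g <- s) f g]].

Record is_grading c : Prop := IsGrading {
  grading0 : forall g, c g 0;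
  gradingB : forall g x y, c g x -> c g y -> c g (x - y);
  grading_sum : forall x, hsum c x;
  grading_direct : forall (s : seq G) (f : G -> V),
    uniq s -> (forall g, c g (f g)) -> \sum_(g <- s) f g = 0 ->
    forall g, g \in s -> f g = 0 }.

Section Closed.
Variable c : G -> set V.
Hypothesis c0 : forall g, c g 0.
Hypothesis cB : forall g x y, c g x -> c g y -> c g (x - y).

Lemma hcompN g x : c g x -> c g (- x).
Proof. by move=> cx; rewrite -sub0r; apply: cB. Qed.

Lemma hcompD g x y : c g x -> c g y -> c g (x + y).
Proof. by move=> cx cy; rewrite -[y]opprK; apply: cB => //; apply: hcompN. Qed.

Lemma hcomp_sum g (I : eqType) (r : seq I) (F : I -> V) :
  (forall i, i \in r -> c g (F i)) -> c g (\sum_(i <- r) F i).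
Proof.
move=> cF; rewrite big_seq; apply: (big_ind (c g)) => // x y; exact: hcompD.
Qed.

Lemma hsum_list (I : eqType) (r : seq I) (d : I -> G) (F : I -> V) :
  (forall i, i \in r -> c (d i) (F i)) -> hsum c (\sum_(i <- r) F i).
Proof.
move=> cF.
exists (undup [seq d i | i <- r]), (fun g => \sum_(i <- r | d i == g) F i).
split; first exact: undup_uniq.
- move=> g; rewrite -big_filter; apply: hcomp_sum => i.
  by rewrite mem_filter => /andP[/eqP <-]; exact: cF.
rewrite (exchange_big_dep xpredT) //= big_seq [RHS]big_seq.
apply: eq_bigr => i ir.
rewrite -big_filter (_ : [seq g <- _ | d i == g] = [:: d i]) ?big_seq1 //.
rewrite (@eq_filter _ _ (pred1 (d i))); last by move=> g; rewrite /= eq_sym.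
rewrite filter_pred1_uniq ?undup_uniq // mem_undup.
exact: map_f.
Qed.

Lemma hsum0 : hsum c 0.
Proof. by exists [::], (fun=> 0); split => //; rewrite big_nil. Qed.

Lemma hsum_hcomp g x : c g x -> hsum c x.
Proof.
move=> cx; rewrite -[x](big_seq1 +%R tt (fun=> x)).
by apply: (@hsum_list _ _ (fun=> g)).
Qed.

Lemma hsumB x y : hsum c x -> hsum c y -> hsum c (x - y).
Proof.
move=> [s [f [_ cf ->]]] [t [f' [_ cf' ->]]].
pose d (i : G + G) := match i with inl g => g | inr g => g end.
pose F (i : G + G) := match i with inl g => f g | inr g => - f' g end.
have -> : \sum_(g <- s) f g - \sum_(g <- t) f' g =
          \sum_(i <- map inl s ++ map inr t) F i.
  by rewrite big_cat !big_map sumrN.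
by apply: (@hsum_list _ _ d) => -[g|g] _ /=; [exact: cf | exact/hcompN/cf'].
Qed.

Lemma hsumD x y : hsum c x -> hsum c y -> hsum c (x + y).
Proof.
move=> hx hy; rewrite -[y]opprK -[- y]sub0r; apply: hsumB => //.
exact: hsumB hsum0 hy.
Qed.

Lemma hsum_sum (I : eqType) (r : seq I) (F : I -> V) :
  (forall i, i \in r -> hsum c (F i)) -> hsum c (\sum_(i <- r) F i).
Proof.
move=> cF; rewrite big_seq; apply: (big_ind (hsum c)) => //.
- exact: hsum0.
- exact: hsumD.
Qed.

Lemma hsum_ind (P : V -> Prop) :
  P 0 -> (forall x y, P x -> P y -> P (x + y)) ->
  (forall g x, c g x -> P x) -> forall x, hsum c x -> P x.
Proof.
move=> P0 PD Pc x [s [f [_ cf ->]]]; apply: big_ind => // g _; exact: Pc (cf g).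
Qed.

Lemma is_grading_proj (p : G -> V -> V) :
  (forall x, hsum c x) ->
  (forall g x y, p g (x + y) = p g x + p g y) ->
  (forall g x, c g x -> p g x = x) ->
  (forall g g' x, c g x -> g' != g -> p g' x = 0) ->
  is_grading c.
Proof.
move=> csum pD pid p0; split=> // s f us cf sf0 g gs.
have pg0 : p g 0 = 0.
  by apply: (@addrI _ (p g 0)); rewrite -pD !addr0.
have := congr1 (p g) sf0; rewrite (big_morph (p g) (pD g) pg0) pg0.
rewrite (bigD1_seq g) //= (pid _ _ (cf g)) big1 ?addr0 // => g' g'g.
by apply: p0 (cf g') _; rewrite eq_sym.
Qed.

End Closed.

Section Proj.
Variables (c : G -> set V) (gr : is_grading c).

Lemma gdecomp x : exists sf : seq G * (G -> V),
  [/\ uniq sf.1, forall g, c g (sf.2 g), forall g, g \notin sf.1 -> sf.2 g = 0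
    & x = \sum_(g <- sf.1) sf.2 g].
Proof.
have [s [f [us cf ->]]] := grading_sum gr x.
exists (s, fun g => if g \in s then f g else 0); split=> //=.
- by move=> g; case: ifP => _ //; exact: (grading0 gr).
- by move=> g /negbTE ->.
- by rewrite big_seq [RHS]big_seq; apply: eq_bigr => g ->.
Qed.

Definition gsupp x : seq G := (sval (cid (gdecomp x))).1.
Definition gproj g x : V := (sval (cid (gdecomp x))).2 g.

Lemma gsupp_uniq x : uniq (gsupp x).
Proof. by rewrite /gsupp; case: cid => ? []. Qed.

Lemma gprojP g x : c g (gproj g x).
Proof. by rewrite /gproj; case: cid => ? []. Qed.

Lemma gproj_out g x : g \notin gsupp x -> gproj g x = 0.
Proof. by rewrite /gproj /gsupp; case: cid => ? [] ? ? h ? /=; exact: h. Qed.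

Lemma gproj_sum x : x = \sum_(g <- gsupp x) gproj g x.
Proof. by rewrite /gproj /gsupp; case: cid => ? []. Qed.

Lemma gsupp_sum (W : zmodType) (x : V) (s : seq G) (F : G -> W) :
  uniq s -> {subset gsupp x <= s} ->
  (forall g, gproj g x = 0 -> F g = 0) ->
  \sum_(g <- gsupp x) F g = \sum_(g <- s) F g.
Proof.
move=> us sub F0; rewrite [RHS](bigID (mem (gsupp x))) /=.
rewrite [X in _ = _ + X]big1 ?addr0; last by move=> g /gproj_out /F0.
rewrite -[RHS]big_filter; apply: perm_big; apply: uniq_perm.
- exact: gsupp_uniq.
- exact: filter_uniq.
- by move=> g; rewrite mem_filter; case: (boolP (g \in gsupp x)) => //= /sub ->.
Qed.

Lemma gproj_uniq x (s : seq G) (f : G -> V) : uniq s ->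
  (forall g, c g (f g)) -> (forall g, g \notin s -> f g = 0) ->
  x = \sum_(g <- s) f g -> forall g, gproj g x = f g.
Proof.
move=> us cf f0 xE g.
pose t := undup (g :: gsupp x ++ s).
have ut : uniq t by exact: undup_uniq.
have E : \sum_(g <- t) (gproj g x - f g) = 0.
  rewrite sumrB -(@gsupp_sum _ x t (gproj^~ x)) //; last first.
    by move=> a ax; rewrite mem_undup inE mem_cat ax orbT.
  rewrite -gproj_sum {1}xE; apply/eqP; rewrite subr_eq0; apply/eqP.
  rewrite [RHS](bigID (mem s)) /=.
  rewrite [X in _ = _ + X]big1 ?addr0; last by move=> a /f0.
  rewrite -[RHS]big_filter; apply: perm_big; apply: uniq_perm => //.
    exact: filter_uniq.
  move=> a; rewrite mem_filter mem_undup inE mem_cat.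
  by case: (boolP (a \in s)) => //= _; rewrite !orbT.
apply/eqP; rewrite -subr_eq0; apply/eqP.
apply: (grading_direct gr ut _ E); last by rewrite mem_undup mem_head.
by move=> a; apply: (gradingB gr) => //; exact: gprojP.
Qed.

Lemma gprojD g x y : gproj g (x + y) = gproj g x + gproj g y.
Proof.
pose t := undup (gsupp x ++ gsupp y).
have ut : uniq t by exact: undup_uniq.
apply: (@gproj_uniq _ t (fun g => gproj g x + gproj g y)) => //.
- move=> a; apply: (hcompD (grading0 gr) (gradingB gr)); exact: gprojP.
- move=> a; rewrite mem_undup mem_cat negb_or => /andP[/gproj_out -> /gproj_out ->].
  by rewrite addr0.
- rewrite big_split /= -(@gsupp_sum _ x t (gproj^~ x)) //; last first.
    by move=> a ax; rewrite mem_undup mem_cat ax.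
  rewrite -(@gsupp_sum _ y t (gproj^~ y)) -?gproj_sum //.
  by move=> a ax; rewrite mem_undup mem_cat ax orbT.
Qed.

Lemma gproj_hom g g' x : c g x -> gproj g' x = if g' == g then x else 0.
Proof.
move=> cx.
apply: (@gproj_uniq x [:: g] (fun a => if a == g then x else 0)) => //.
- by move=> a; case: eqP => [->|_] //; exact: (grading0 gr).
- by move=> a; rewrite inE => /negbTE ->.
- by rewrite big_seq1 eqxx.
Qed.

Lemma gproj_id g x : c g x -> gproj g x = x.
Proof. by move=> cx; rewrite (gproj_hom _ cx) eqxx. Qed.

Lemma grading_ind (P : V -> Prop) :
  P 0 -> (forall x y, P x -> P y -> P (x + y)) ->
  (forall g x, c g x -> P x) -> forall x, P x.
Proof. by move=> P0 PD Pc x; apply: (hsum_ind P0 PD Pc (grading_sum gr x)). Qed.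

Section Fold.
Variables (W : zmodType) (F : G -> V -> W).
Hypothesis FD : forall g x y, F g (x + y) = F g x + F g y.

Definition gfold x : W := \sum_(g <- gsupp x) F g (gproj g x).

Let F0 g : F g 0 = 0.
Proof. by apply: (@addrI _ (F g 0)); rewrite -FD !addr0. Qed.

Lemma gfoldD x y : gfold (x + y) = gfold x + gfold y.
Proof.
pose t := undup (gsupp (x + y) ++ gsupp x ++ gsupp y).
have ut : uniq t by exact: undup_uniq.
rewrite /gfold.
rewrite (@gsupp_sum _ _ t (fun g => F g (gproj g (x + y)))) //; first last.
- by move=> g ->.
- by move=> g gs; rewrite mem_undup mem_cat gs.
rewrite (@gsupp_sum _ x t (fun g => F g (gproj g x))) //; first last.
- by move=> g ->.
- by move=> g gs; rewrite mem_undup !mem_cat gs orbT.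
rewrite (@gsupp_sum _ y t (fun g => F g (gproj g y))) //; first last.
- by move=> g ->.
- by move=> g gs; rewrite mem_undup !mem_cat gs !orbT.
by rewrite -big_split; apply: eq_bigr => g _; rewrite gprojD FD.
Qed.

Lemma gfold_hom g x : c g x -> gfold x = F g x.
Proof.
move=> cx; pose t := undup (g :: gsupp x).
have ut : uniq t by exact: undup_uniq.
rewrite /gfold (@gsupp_sum _ x t (fun g => F g (gproj g x))) //; first last.
- by move=> a ->.
- by move=> a gs; rewrite mem_undup inE gs orbT.
rewrite (bigD1_seq g) ?mem_undup ?mem_head //= gproj_id // big1 ?addr0 //.
by move=> a /negbTE ag; rewrite (gproj_hom _ cx) ag.
Qed.

End Fold.
End Proj.
End Grading.

(* That 1 has degree 0 follows from the other requirements: see gring1. *)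
Record gradedRing (G : zmodType) := GradedRing {
  gring_sort :> comPzRingType;
  gring_comp : G -> set gring_sort;
  gring_grading : is_grading gring_comp;
  gring_mul : forall g g' x y,
    gring_comp g x -> gring_comp g' y -> gring_comp (g + g') (x * y) }.

Record gringMor (G : zmodType) (R S : gradedRing G) := GringMor {
  gringMor_fun :> {rmorphism R -> S};
  gringMor_deg : forall g x, gring_comp g x -> gring_comp g (gringMor_fun x) }.

Record gradedMod (G : zmodType) (R : gradedRing G) := GradedMod {
  gmod_sort :> lmodType R;
  gmod_comp : G -> set gmod_sort;
  gmod_grading : is_grading gmod_comp;
  gmod_scale : forall g g' (r : R) (x : gmod_sort),
    gring_comp g r -> gmod_comp g' x -> gmod_comp (g + g') (r *: x) }.

Section GradedModules.
Variables (G : zmodType) (R : gradedRing G).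
Implicit Types M N P : gradedMod R.

Lemma gring1 : gring_comp 0 (1 : R).
Proof.
set e := gproj (gring_grading R) 0 1.
suff -> : (1 : R) = e by exact: gprojP.
have eM (y : R) : e * y = y.
  elim/(grading_ind (gring_grading R)): y => [|x y ex ey|g y cy].
  - by rewrite mulr0.
  - by rewrite mulrDr ex ey.
  pose t := undup (0 :: gsupp (gring_grading R) 1).
  have := gproj_id (gring_grading R) cy.
  rewrite -{1}[y]mul1r {1}(gproj_sum (gring_grading R) 1).
  rewrite (@gsupp_sum _ _ _ (gring_grading R) _ 1 t (gproj (gring_grading R) ^~ 1));
    rewrite ?undup_uniq //; last by move=> a at1; rewrite mem_undup inE at1 orbT.
  have pg0 : gproj (gring_grading R) g 0 = 0.
    by rewrite (gproj_hom _ g (grading0 (gring_grading R) g)) eqxx.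
  rewrite mulr_suml (big_morph _ (gprojD (gring_grading R) g) pg0).
  rewrite (bigD1_seq 0) ?undup_uniq ?mem_undup ?mem_head //= big1 ?addr0.
    have := gring_mul (gprojP (gring_grading R) 0 1) cy.
    by rewrite add0r => /(gproj_id (gring_grading R)) ->.
  move=> a a0; have := gring_mul (gprojP (gring_grading R) a 1) cy.
  move=> /(gproj_hom (gring_grading R) g) ->.
  by rewrite -subr_eq0 opprD addrCA subrr addr0 oppr_eq0 (negbTE a0).
by rewrite -(eM 1) mulr1.
Qed.

Definition is_gmor M N (u : M -> N) : Prop :=
  linear u /\ forall g x, gmod_comp g x -> gmod_comp g (u x).

Definition gmor_pred M N : {pred M -> N} := fun u => `[< is_gmor u >].

Lemma gmor_zmod_closed M N : zmod_closed (@gmor_pred M N).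
Proof.
split=> [|u v /asboolP[lu du] /asboolP[lv dv]]; apply/asboolP; split.
- by move=> a x y; exact: esym (etrans (addr0 _) (scaler0 _ _)).
- by move=> g x _; exact: grading0 (gmod_grading N) _.
- by move=> a x y; rewrite !fctE lu lv scalerBr opprD addrACA.
- by move=> g x cx; rewrite !fctE; apply: (gradingB (gmod_grading N)); auto.
Qed.

HB.instance Definition _ M N :=
  GRing.isZmodClosed.Build (M -> N) (@gmor_pred M N) (gmor_zmod_closed M N).

Record gmor M N := Gmor { gmor_fun :> M -> N; gmor_subproof : gmor_fun \in @gmor_pred M N }.

HB.instance Definition _ M N := [isSub for @gmor_fun M N].
HB.instance Definition _ M N := [Choice of gmor M N by <:].
HB.instance Definition _ M N := [SubChoice_isSubZmodule of gmor M N by <:].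

Lemma gmorP M N (u : gmor M N) : is_gmor u.
Proof. exact/asboolP/gmor_subproof. Qed.

HB.instance Definition _ M N (u : gmor M N) :=
  GRing.isLinear.Build R M N *:%R u (gmorP u).1.

Definition mk_gmor M N (u : M -> N) (hu : is_gmor u) : gmor M N :=
  Gmor (asboolT hu).

Lemma gmorE M N (u v : gmor M N) : u =1 v -> u = v.
Proof. by move=> uv; apply: val_inj; apply: funext. Qed.

Lemma is_gmor_id M : is_gmor (@id M).
Proof. by split. Qed.

Lemma is_gmor_comp M N P (v : N -> P) (u : M -> N) :
  is_gmor v -> is_gmor u -> is_gmor (v \o u).
Proof.
move=> [lv dv] [lu du]; split=> [a x y|g x cx] /=; first by rewrite lu lv.
exact/dv/du.
Qed.

Definition gmor_id M : gmor M M := mk_gmor (is_gmor_id M).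

Definition gmor_comp M N P (v : gmor N P) (u : gmor M N) : gmor M P :=
  mk_gmor (is_gmor_comp (gmorP v) (gmorP u)).

Definition gMod : category.
Proof.
by refine (@Category (gradedMod R) gmor gmor_id gmor_comp _ _ _);
  intros; apply: gmorE.
Defined.

Lemma shift_grading M (g : G) :
  is_grading (fun g' => gmod_comp (g + g') : set M).
Proof.
have gr := gmod_grading M.
apply: (@is_grading_proj _ _ _ _ _ (fun a => gproj gr (g + a))).
- by move=> a; exact: grading0 gr _.
- by move=> a x y; exact: gradingB gr _ _ _.
- elim/(grading_ind gr) => [|x y hx hy|a x cx].
  + by apply: hsum0 => a; exact: grading0 gr _.
  + apply: hsumD => //; first by move=> a; exact: grading0 gr _.
    by move=> a z t; exact: gradingB gr _ _ _.
  + apply: (@hsum_hcomp _ _ _ _ _ (a - g)); last by rewrite addrC subrK.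
    * by move=> b; exact: grading0 gr _.
    * by move=> b z t; exact: gradingB gr _ _ _.
- by move=> a x y; exact: gprojD.
- by move=> a x; exact: gproj_id.
- move=> a b x cx ba; rewrite (gproj_hom _ _ cx).
  by rewrite (inj_eq (addrI g)) (negbTE ba).
Qed.

Lemma shift_scale M (h : G) g g' (r : R) (x : M) :
  gring_comp g r -> gmod_comp (h + g') x -> gmod_comp (h + (g + g')) (r *: x).
Proof. by move=> cr cx; rewrite addrCA; exact: gmod_scale. Qed.

(* M(g) *)
Definition gshift M (g : G) : gradedMod R :=
  GradedMod (shift_grading M g) (@shift_scale M g).

(* R as a graded module over itself *)
Definition gregular : gradedMod R :=
  @GradedMod G R R^o (@gring_comp G R) (gring_grading R) (@gring_mul G R).

(* The direct sum of the R(d i) for i in I has underlying module R^I. *)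
Section Free.
Variables (I : finType) (d : I -> G).

Definition gfree_comp (g : G) : set {ffun I -> R^o} :=
  [set x | forall i, gmod_comp g (x i : gshift gregular (d i))].

Lemma gfree_grading : is_grading gfree_comp.
Proof.
pose gr i := gmod_grading (gshift gregular (d i)).
have c0 g : gfree_comp g 0 by move=> i; rewrite ffunE; exact: grading0 (gr i) _.
have cB g x y : gfree_comp g x -> gfree_comp g y -> gfree_comp g (x - y).
  by move=> cx cy i; rewrite !ffunE; apply: (gradingB (gr i)); auto.
pose p g (x : {ffun I -> R^o}) : {ffun I -> R^o} := [ffun i => gproj (gr i) g (x i)].
apply: (@is_grading_proj _ _ _ c0 cB p).
- move=> x.
  pose e i (y : R^o) : {ffun I -> R^o} := [ffun j => if j == i then y else 0].
  have -> : x = \sum_(i <- enum I) e i (x i).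
    apply/ffunP => j; rewrite sum_ffunE (bigD1_seq j) ?mem_enum ?enum_uniq //=.
    rewrite ffunE eqxx big1 ?addr0 // => i /negbTE ij.
    by rewrite ffunE eq_sym ij.
  apply: hsum_sum => // i _; elim/(grading_ind (gr i)): (x i) => [|y z hy hz|g y cy].
  + rewrite (_ : e i 0 = 0); first exact: hsum0.
    by apply/ffunP => j; rewrite !ffunE if_same.
  + rewrite (_ : e i _ = e i y + e i z); first exact: hsumD.
    by apply/ffunP => j; rewrite !ffunE; case: ifP; rewrite ?addr0.
  + apply: (@hsum_hcomp _ _ _ c0 cB g) => j; rewrite ffunE.
    by case: eqP => [->|_] //; exact: grading0 (gr j) _.
- by move=> g x y; apply/ffunP => i; rewrite !ffunE gprojD.
- by move=> g x cx; apply/ffunP => i; rewrite ffunE gproj_id.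
- move=> g g' x cx gg'; apply/ffunP => i.
  by rewrite !ffunE (gproj_hom (gr i) g' (cx i)) (negbTE gg').
Qed.

Lemma gfree_scale g g' (r : R) x :
  gring_comp g r -> gfree_comp g' x -> gfree_comp (g + g') (r *: x).
Proof.
by move=> cr cx i; rewrite ffunE; apply: (@gmod_scale _ _ (gshift gregular (d i))).
Qed.

Definition gfree : gradedMod R := GradedMod gfree_grading gfree_scale.

End Free.

Definition finite_type (M : gradedMod R) : Prop :=
  exists (I : finType) (d : I -> G) (L : gMod) (f : @hom gMod L M),
    @isomorphic gMod L (gfree d) /\ epi f.

End GradedModules.

Definition short_exact (A B C : zmodType) (f : A -> B) (g : B -> C) : Prop :=
  [/\ injective f,
      forall b, g b = 0 <-> exists a, b = f a
    & forall c, exists b, g b = c].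

Definition projective (G : zmodType) (R : gradedRing G) (M : gradedMod R) : Prop :=
  forall (A B C : gradedMod R) (f : gmor A B) (g : gmor B C),
    short_exact f g ->
    short_exact (fun u : gmor M A => gmor_comp f u)
                (fun u : gmor M B => gmor_comp g u).

(* Graded Hom. The direct sum over d of the groups Hom(M, N(d)) is realized  *)
(* as their sum inside the group of all maps M -> N, N(d) and N having the   *)
(* same underlying module; lemma gHom_grading says that this sum is direct.  *)

Section GradedHom.
Variables (G : zmodType) (R : gradedRing G).
Implicit Types M N P : gradedMod R.

Definition hom_deg M N (d : G) : set (M -> N) :=
  [set u | is_gmor (u : M -> gshift N d)].

Lemma hom_deg0 M N d : @hom_deg M N d 0.
Proof. by have [/asboolP] := gmor_zmod_closed M (gshift N d). Qed.

Lemma hom_degB M N d u v :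
  @hom_deg M N d u -> @hom_deg M N d v -> @hom_deg M N d (u - v).
Proof.
move=> hu hv; have [_ cB] := gmor_zmod_closed M (gshift N d).
by apply/asboolP; apply: (cB u v); apply/asboolP.
Qed.

Lemma hom_deg_comp M N P d e (v : N -> P) (u : M -> N) :
  hom_deg d v -> hom_deg e u -> hom_deg (d + e) (v \o u).
Proof.
move=> [lv dv] [lu du]; split=> [a x y|g x cx] /=; first by rewrite lu lv.
by have := dv _ _ (du _ _ cx); rewrite /= addrA.
Qed.

Lemma hsum_hom_linear M N (u : M -> N) : hsum (@hom_deg M N) u -> linear u.
Proof.
elim/hsum_ind => [|v w lv lw|d v []//] a x y.
- exact: esym (etrans (addr0 _) (scaler0 _ _)).
- by rewrite !fctE lv lw scalerDr addrACA.
Qed.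

Lemma hsum_hom_comp M N P (v : N -> P) (u : M -> N) :
  hsum (@hom_deg N P) v -> hsum (@hom_deg M N) u ->
  hsum (@hom_deg M P) (v \o u).
Proof.
move=> hv hu.
have c0 := @hom_deg0 M P; have cB := @hom_degB M P.
elim/hsum_ind: (hv) => [|v1 v2 h1 h2|d v1 h1].
- by rewrite (_ : _ \o _ = (0 : M -> P)); [exact: hsum0 | apply: funext].
- pose w1 : N -> P := v1; pose w2 : N -> P := v2.
  rewrite (_ : _ \o _ = (w1 \o u : M -> P) + (w2 \o u : M -> P)).
    exact: hsumD.
  exact: funext.
have v1D x y : v1 (x + y) = v1 x + v1 y.
  by have := h1.1 1 x y; rewrite !scale1r.
elim/hsum_ind: (hu) => [|u1 u2 k1 k2|e u1 k1].
- rewrite (_ : _ \o _ = (0 : M -> P)); first exact: hsum0.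
  apply: funext => x; apply: (@addrI _ (v1 0)).
  by rewrite -[LHS]v1D addr0; exact: esym (addr0 _).
- pose w1 : M -> N := u1; pose w2 : M -> N := u2.
  rewrite (_ : _ \o _ = (v1 \o w1 : M -> P) + (v1 \o w2 : M -> P)).
    exact: hsumD.
  by apply: funext => x; exact: v1D.
exact: hsum_hcomp (hom_deg_comp h1 k1).
Qed.

Lemma hsum_scale M (r : R) : hsum (@hom_deg M M) (fun x => r *: x).
Proof.
elim/(grading_ind (gring_grading R)): r => [|r s hr hs|d r cr].
- rewrite (_ : (fun _ => _) = 0); first by apply: hsum0; exact: hom_deg0.
  by apply: funext => x; rewrite scale0r.
- rewrite (_ : (fun _ => _) = (fun x => r *: x) + (fun x => s *: x)).
    by apply: hsumD => //; [exact: hom_deg0 | exact: hom_degB].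
  by apply: funext => x; rewrite !fctE scalerDl.
apply: (@hsum_hcomp _ _ _ _ _ d); [exact: hom_deg0 | exact: hom_degB|].
split=> [a x y|g x cx]; first by rewrite scalerDr !scalerA mulrC.
exact: gmod_scale.
Qed.

Definition gHom_pred M N : {pred M -> N} := fun u => `[< hsum (@hom_deg M N) u >].

Lemma gHom_submod_closed M N : submod_closed (@gHom_pred M N).
Proof.
split=> [|r u v /asboolP hu /asboolP hv]; apply/asboolP.
- by apply: hsum0; exact: hom_deg0.
apply: hsumD => //; [exact: hom_deg0 | exact: hom_degB |].
exact: (hsum_hom_comp (hsum_scale N r) hu).
Qed.

HB.instance Definition _ M N :=
  GRing.isSubmodClosed.Build R (M -> N) (@gHom_pred M N) (gHom_submod_closed M N).

Record gHom M N := GHom { gHom_fun :> M -> N; gHom_subproof : gHom_fun \in @gHom_pred M N }.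

HB.instance Definition _ M N := [isSub for @gHom_fun M N].
HB.instance Definition _ M N := [Choice of gHom M N by <:].
HB.instance Definition _ M N := [SubChoice_isSubLmodule of gHom M N by <:].

Lemma gHomP M N (u : gHom M N) : hsum (@hom_deg M N) u.
Proof. exact/asboolP/gHom_subproof. Qed.

HB.instance Definition _ M N (u : gHom M N) :=
  GRing.isLinear.Build R M N *:%R u (hsum_hom_linear (gHomP u)).

Definition mk_gHom M N (u : M -> N) (hu : hsum (@hom_deg M N) u) : gHom M N :=
  GHom (asboolT hu).

Lemma gHomE M N (u v : gHom M N) : u =1 v -> u = v.
Proof. by move=> uv; apply: val_inj; apply: funext. Qed.

Definition gHom_comp M N (d : G) : set (gHom M N) :=
  [set u | hom_deg d (u : M -> N)].

Lemma gHom_grading M N : is_grading (@gHom_comp M N).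
Proof.
split.
- by move=> d; exact: hom_deg0.
- by move=> d u v; exact: hom_degB.
- move=> u; have [s [f [us hf uE]]] := gHomP u.
  have hs d : hsum (@hom_deg M N) (f d).
    by apply: hsum_hcomp (hf d); [exact: hom_deg0 | exact: hom_degB].
  exists s, (fun d => mk_gHom (hs d)); split => //.
  by apply: val_inj; rewrite [LHS]uE raddf_sum.
- move=> s f us hf sf0 d ds; apply: gHomE => x.
  elim/(grading_ind (gmod_grading M)): x => [|x y hx hy|g x cx].
  + exact: raddf0.
  + by rewrite raddfD /= hx hy; exact: addr0.
  pose t := [seq d + g | d <- s].
  have ut : uniq t by rewrite map_inj_uniq //; exact: addIr.
  have := @grading_direct _ _ _ (gmod_grading N) t (fun a => f (a - g) x) ut _ _ (d + g).
  rewrite addrK; apply.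
  + by move=> a; have := (hf (a - g)).2 g x cx; rewrite /= subrK.
  + rewrite big_map; have := congr1 (fun u : gHom M N => val u x) sf0.
    rewrite raddf_sum fct_sumE /= => sx0.
    by under eq_bigr => i _ do rewrite addrK.
  + by apply: map_f.
Qed.

Lemma gHom_scale M N g g' (r : R) (u : gHom M N) :
  gring_comp g r -> gHom_comp g' u -> gHom_comp (g + g') (r *: u).
Proof.
move=> cr [lu du].
suff h : is_gmor (val (r *: u) : M -> gshift N (g + g')) by exact: h.
split=> [a x y|b x cx]; first exact: (linearP (r *: u)).
by have := gmod_scale cr (du _ _ cx); rewrite /= addrA [g' + g]addrC.
Qed.

Definition gHom_gmod M N : gradedMod R :=
  GradedMod (gHom_grading M N) (@gHom_scale M N).

End GradedHom.


(* Tensor product of modules, as the group of formal sums of pairs (m, n)    *)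
(* modulo the following relation: two formal sums are identified when every  *)
(* balanced biadditive map to an abelian group takes the same value on both. *)
(* Theorem tensor_universal is the universal property.                       *)

Section Tensor.
Variables (R : comPzRingType) (M N : lmodType R).
Implicit Types (s t : seq (M * N)) (m : M) (n : N).

Definition balanced (W : zmodType) (f : M -> N -> W) : Prop :=
  [/\ forall m m' n, f (m + m') n = f m n + f m' n,
      forall m n n', f m (n + n') = f m n + f m n'
    & forall (r : R) m n, f (r *: m) n = f m (r *: n)].

Definition bival (W : zmodType) (f : M -> N -> W) s : W :=
  \sum_(p <- s) f p.1 p.2.

Definition tensor_rel s t : bool :=
  `[< forall (W : zmodType) (f : M -> N -> W), balanced f -> bival f s = bival f t >].

Lemma tensor_rel_refl : reflexive tensor_rel.
Proof. by move=> s; apply/asboolP. Qed.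

Lemma tensor_rel_sym : symmetric tensor_rel.
Proof.
by move=> s t; apply/idP/idP => /asboolP h; apply/asboolP => W f bf; rewrite h.
Qed.

Lemma tensor_rel_trans : transitive tensor_rel.
Proof.
move=> t s u /asboolP h /asboolP k; apply/asboolP => W f bf.
by rewrite h // k.
Qed.

Canonical tensor_equiv :=
  EquivRel tensor_rel tensor_rel_refl tensor_rel_sym tensor_rel_trans.

Definition tensor : Type := {eq_quot tensor_equiv}%qT.
HB.instance Definition _ := Choice.on tensor.
HB.instance Definition _ := EqQuotient.on tensor.

Local Open Scope quotient_scope.

Definition tmk s : tensor := \pi_tensor s.

Lemma tmkP s t : (tmk s = tmk t) <->
  (forall (W : zmodType) (f : M -> N -> W), balanced f -> bival f s = bival f t).
Proof.
split=> [/eqP|h]; first by rewrite /tmk eqmodE => /asboolP.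
by apply/eqP; rewrite /tmk eqmodE; apply/asboolP.
Qed.

Lemma tmk_repr (x : tensor) : tmk (repr x) = x.
Proof. exact: reprK. Qed.

Lemma bival_repr (W : zmodType) (f : M -> N -> W) s :
  balanced f -> bival f (repr (tmk s)) = bival f s.
Proof. by move: W f; apply/tmkP; rewrite tmk_repr. Qed.

Definition topp (s : seq (M * N)) := [seq (- p.1, p.2) | p <- s].

Lemma balanced0l (W : zmodType) (f : M -> N -> W) n : balanced f -> f 0 n = 0.
Proof. by case=> fD _ _; apply: (@addrI _ (f 0 n)); rewrite -fD !addr0. Qed.

Lemma balancedNl (W : zmodType) (f : M -> N -> W) m n :
  balanced f -> f (- m) n = - f m n.
Proof.
move=> bf; apply: (@addrI _ (f m n)); case: (bf) => fD _ _.
by rewrite -fD !subrr balanced0l.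
Qed.

Lemma bival_cat (W : zmodType) (f : M -> N -> W) s t :
  bival f (s ++ t) = bival f s + bival f t.
Proof. exact: big_cat. Qed.

Lemma bival_opp (W : zmodType) (f : M -> N -> W) s :
  balanced f -> bival f (topp s) = - bival f s.
Proof.
move=> bf; rewrite /bival big_map -sumrN; apply: eq_bigr => p _ /=.
exact: balancedNl.
Qed.

Definition tadd (x y : tensor) : tensor := tmk (repr x ++ repr y).
Definition tneg (x : tensor) : tensor := tmk (topp (repr x)).

Lemma tadd_mk s t : tadd (tmk s) (tmk t) = tmk (s ++ t).
Proof. by apply/tmkP => W f bf; rewrite !bival_cat !bival_repr. Qed.

Lemma tneg_mk s : tneg (tmk s) = tmk (topp s).
Proof. by apply/tmkP => W f bf; rewrite !bival_opp // bival_repr. Qed.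

Lemma taddA : associative tadd.
Proof.
move=> x y z; rewrite -[x]tmk_repr -[y]tmk_repr -[z]tmk_repr !tadd_mk.
by rewrite catA.
Qed.

Lemma taddC : commutative tadd.
Proof.
move=> x y; rewrite -[x]tmk_repr -[y]tmk_repr !tadd_mk.
by apply/tmkP => W f bf; rewrite !bival_cat addrC.
Qed.

Lemma tadd0 : left_id (tmk [::]) tadd.
Proof. by move=> x; rewrite -[x]tmk_repr tadd_mk. Qed.

Lemma taddN : left_inverse (tmk [::]) tneg tadd.
Proof.
move=> x; rewrite -[x]tmk_repr tneg_mk tadd_mk.
by apply/tmkP => W f bf; rewrite bival_cat bival_opp // addNr /bival big_nil.
Qed.

HB.instance Definition _ := GRing.isZmodule.Build tensor taddA taddC tadd0 taddN.

Definition pure m n : tensor := tmk [:: (m, n)].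

Definition tlift (W : zmodType) (f : M -> N -> W) (x : tensor) : W :=
  bival f (repr x).

Lemma tmk_sum s : tmk s = \sum_(p <- s) pure p.1 p.2.
Proof.
elim: s => [|[m n] s ih]; first by rewrite big_nil.
by rewrite big_cons -ih /=; apply: esym; exact: tadd_mk.
Qed.

Lemma tensor_sum (x : tensor) : exists s, x = \sum_(p <- s) pure p.1 p.2.
Proof. by exists (repr x); rewrite -tmk_sum tmk_repr. Qed.

Lemma pure_balanced : balanced pure.
Proof.
have addE s t : tmk s + tmk t = tmk (s ++ t) by exact: tadd_mk.
split=> [m m' n|m n n'|r m n]; rewrite /pure ?addE;
  apply/tmkP => W f [fDl fDr fZ]; rewrite /bival /= ?big_cons ?big_nil ?addr0 /=.
- exact: fDl.
- exact: fDr.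
- exact: fZ.
Qed.

Lemma tlift_pure (W : zmodType) (f : M -> N -> W) m n :
  balanced f -> tlift f (pure m n) = f m n.
Proof. by move=> bf; rewrite /tlift bival_repr // /bival big_seq1. Qed.

Lemma tliftD (W : zmodType) (f : M -> N -> W) (x y : tensor) :
  balanced f -> tlift f (x + y) = tlift f x + tlift f y.
Proof.
by move=> bf; rewrite -[x + y]/(tadd x y) /tlift bival_repr // bival_cat.
Qed.

Lemma tensor_ind (P : tensor -> Prop) :
  P 0 -> (forall x y, P x -> P y -> P (x + y)) -> (forall m n, P (pure m n)) ->
  forall x, P x.
Proof.
move=> P0 PD Pp x; have [s ->] := tensor_sum x.
by apply: big_ind => // p _; exact: Pp.
Qed.

Theorem tensor_universal (W : zmodType) (f : M -> N -> W) : balanced f ->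
  exists F : {additive tensor -> W}, (forall m n, F (pure m n) = f m n) /\
    forall F' : {additive tensor -> W},
      (forall m n, F' (pure m n) = f m n) -> F' =1 F.
Proof.
move=> bf.
have F0 : tlift f 0 = 0.
  by apply: (@addrI _ (tlift f 0)); rewrite -tliftD // !addr0.
have FD : nmod_morphism (tlift f) by split => // x y; exact: tliftD.
pose Fa := GRing.isNmodMorphism.Build tensor W (tlift f) FD.
pose F : {additive tensor -> W} := HB.pack (tlift f) Fa.
exists F; split=> [m n|F' F'E]; first exact: tlift_pure.
elim/tensor_ind => [|x y hx hy|m n].
- by rewrite !raddf0.
- by rewrite !raddfD /= hx hy.
- by rewrite F'E; exact: esym (tlift_pure _ _ bf).
Qed.

End Tensor.

Section TensorMap.
Variable R : comPzRingType.
Implicit Types M N : lmodType R.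

Definition tmap M M' N N' (u : M -> M') (v : N -> N') :
    tensor M N -> tensor M' N' :=
  tlift (fun m n => pure (u m) (v n)).

Lemma linear_add M N (u : M -> N) : linear u -> forall x y, u (x + y) = u x + u y.
Proof. by move=> lu x y; have := lu 1 x y; rewrite !scale1r. Qed.

Lemma linear_zero M N (u : M -> N) : linear u -> u 0 = 0.
Proof.
by move=> lu; apply: (@addrI _ (u 0)); rewrite -(linear_add lu) !addr0.
Qed.

Lemma linear_scale M N (u : M -> N) : linear u -> forall r x, u (r *: x) = r *: u x.
Proof.
by move=> lu r x; have := lu r x 0; rewrite (linear_zero lu) !addr0.
Qed.

Section Map.
Variables (M M' N N' : lmodType R) (u : M -> M') (v : N -> N').
Hypotheses (lu : linear u) (lv : linear v).

Lemma tmap_balanced : balanced (fun m n => pure (u m) (v n)).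
Proof.
have [pDl pDr pZ] := pure_balanced M' N'.
split=> [m m' n|m n n'|r m n].
- by rewrite linear_add // pDl.
- by rewrite (linear_add lv) pDr.
- by rewrite linear_scale // pZ linear_scale.
Qed.

Lemma tmap_pure m n : tmap u v (pure m n) = pure (u m) (v n).
Proof. exact: tlift_pure tmap_balanced. Qed.

Lemma tmapD x y : tmap u v (x + y) = tmap u v x + tmap u v y.
Proof. exact: tliftD tmap_balanced. Qed.

Lemma tmap0 : tmap u v 0 = 0.
Proof. by apply: (@addrI _ (tmap u v 0)); rewrite -tmapD !addr0. Qed.

Lemma tmap_sum (I : Type) (r : seq I) (F : I -> tensor M N) :
  tmap u v (\sum_(i <- r) F i) = \sum_(i <- r) tmap u v (F i).
Proof. exact: (big_morph _ tmapD tmap0). Qed.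

Lemma tmap_unique (f : tensor M N -> tensor M' N') :
  (forall x y, f (x + y) = f x + f y) ->
  (forall m n, f (pure m n) = pure (u m) (v n)) -> f =1 tmap u v.
Proof.
move=> fD fp; elim/tensor_ind => [|x y hx hy|m n].
- by rewrite tmap0; apply: (@addrI _ (f 0)); rewrite -fD !addr0.
- by rewrite fD tmapD hx hy.
- by rewrite fp tmap_pure.
Qed.

End Map.

Lemma linear_id M : linear (@id M).
Proof. by []. Qed.

(* A ring A acting R-linearly on M acts on the tensor product of M and N. *)
Section Action.
Variables (A : comPzRingType) (M N : lmodType R) (act : A -> M -> M).
Hypotheses (actL : forall a, linear (act a))
  (actM : forall a b x, act a (act b x) = act (a * b) x)
  (act1 : forall x, act 1 x = x)
  (actD : forall a b x, act (a + b) x = act a x + act b x).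

Definition tact (a : A) : tensor M N -> tensor M N := tmap (act a) id.

Lemma tact_pure a m n : tact a (pure m n) = pure (act a m) n.
Proof. exact: tmap_pure (actL a) (@linear_id N) m n. Qed.

Lemma tactDr a : {morph tact a : x y / x + y}.
Proof. by move=> x y; exact: tmapD (actL a) (@linear_id N) x y. Qed.

Lemma tact0r a : tact a 0 = 0.
Proof. exact: tmap0 (actL a) (@linear_id N). Qed.

Lemma tactA a b x : tact a (tact b x) = tact (a * b) x.
Proof.
elim/tensor_ind: x => [|x y hx hy|m n]; first by rewrite !tact0r.
  by rewrite !tactDr hx hy.
by rewrite !tact_pure actM.
Qed.

Lemma tact1 : left_id 1 tact.
Proof.
elim/tensor_ind => [|x y hx hy|m n]; first by rewrite tact0r.
  by rewrite tactDr hx hy.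
by rewrite tact_pure act1.
Qed.

Lemma tactDl x : {morph tact^~ x : a b / a + b}.
Proof.
move=> a b /=; elim/tensor_ind: x => [|x y hx hy|m n].
- by rewrite !tact0r addr0.
- by rewrite !tactDr hx hy addrACA.
- by rewrite !tact_pure actD; have [-> _ _] := pure_balanced M N.
Qed.

End Action.

Lemma scale_linear M (r : R) : linear (fun x : M => r *: x).
Proof. by move=> a x y; rewrite scalerDr !scalerA mulrC. Qed.

HB.instance Definition _ M N :=
  let act (r : R) (x : M) := r *: x in
  GRing.Zmodule_isLmodule.Build R (tensor M N)
    (@tactA R M N act (@scale_linear M) (@scalerA R M))
    (@tact1 R M N act (@scale_linear M) (@scale1r R M))
    (@tactDr R M N act (@scale_linear M))
    (@tactDl R M N act (@scale_linear M) (fun a b x => scalerDl x a b)).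

End TensorMap.

Section GradedTensor.
Variables (G : zmodType) (R : gradedRing G) (M N : gradedMod R).

Definition gtensor_comp (g : G) : set (tensor M N) :=
  [set x | exists s : seq (M * N), x = \sum_(p <- s) pure p.1 p.2 /\
     forall p, p \in s -> exists a b,
       [/\ a + b = g, gmod_comp a p.1 & gmod_comp b p.2]].

Let grM := gmod_grading M.
Let grN := gmod_grading N.

Lemma gtensor_comp_pure a b m n :
  gmod_comp a m -> gmod_comp b n -> gtensor_comp (a + b) (pure m n).
Proof.
move=> cm cn; exists [:: (m, n)]; split; first by rewrite big_seq1.
by move=> p; rewrite inE => /eqP ->; exists a, b.
Qed.

Lemma gtensor_comp0 g : gtensor_comp g 0.
Proof. by exists [::]; split => //; rewrite big_nil. Qed.

Lemma pureNl (m : M) (n : N) : pure (- m) n = - pure m n.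
Proof. exact: balancedNl (pure_balanced M N). Qed.

Lemma gtensor_compB g x y :
  gtensor_comp g x -> gtensor_comp g y -> gtensor_comp g (x - y).
Proof.
move=> [s [-> hs]] [t [-> ht]]; exists (s ++ topp t); split.
  rewrite big_cat big_map -sumrN; congr (_ + _).
  by apply: eq_bigr => p _; rewrite pureNl.
move=> p; rewrite mem_cat => /orP[/hs //|/mapP[q /ht [a [b [ab ca cb]]] ->]].
exists a, b; split => //=.
exact: hcompN (grading0 grM) (gradingB grM) _ _ ca.
Qed.

Lemma gtensor_gen (P : tensor M N -> Prop) :
  P 0 -> (forall x y, P x -> P y -> P (x + y)) ->
  (forall a b m n, gmod_comp a m -> gmod_comp b n -> P (pure m n)) ->
  forall x, P x.
Proof.
move=> P0 PD Pp; have [pDl pDr pZ] := pure_balanced M N.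
elim/tensor_ind => // m n.
elim/(grading_ind grM): m => [|x y hx hy|a m cm].
- by rewrite (balanced0l n (pure_balanced M N)).
- by rewrite pDl; exact: PD.
elim/(grading_ind grN): n => [|x y hx hy|b n cn]; last exact: Pp cm cn.
- have -> : pure m (0 : N) = 0 by apply: (@addrI _ (pure m 0)); rewrite -pDr !addr0.
  exact: P0.
- by rewrite pDr; exact: PD.
Qed.

(* the degree g part of m (x) n *)
Definition tproj_fun (g : G) (m : M) (n : N) : tensor M N :=
  gfold grM (fun a x => pure x (gproj grN (g - a) n)) m.

Lemma tproj_funDl g m m' n :
  tproj_fun g (m + m') n = tproj_fun g m n + tproj_fun g m' n.
Proof. by apply: gfoldD => a x y; have [-> _ _] := pure_balanced M N. Qed.

Lemma tproj_funDr g m n n' :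
  tproj_fun g m (n + n') = tproj_fun g m n + tproj_fun g m n'.
Proof.
rewrite /tproj_fun /gfold -big_split; apply: eq_bigr => a _.
by rewrite gprojD; have [_ -> _] := pure_balanced M N.
Qed.

Lemma tproj_fun_hom g a b m n : gmod_comp a m -> gmod_comp b n ->
  tproj_fun g m n = if g == a + b then pure m n else 0.
Proof.
move=> cm cn; have [pDl pDr _] := pure_balanced M N.
rewrite /tproj_fun (gfold_hom grM (F := fun a x => pure x (gproj grN (g - a) n)) _ cm).
  rewrite (gproj_hom grN _ cn) subr_eq [b + a]addrC; case: ifP => // _.
  by apply: (@addrI _ (pure m 0)); rewrite -pDr !addr0.
by move=> c x y; rewrite pDl.
Qed.

Lemma tproj_balanced g : balanced (tproj_fun g).
Proof.
split=> [m m' n|m n n'|r m n]; [exact: tproj_funDl|exact: tproj_funDr|].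
have f0l n' : tproj_fun g 0 n' = 0.
  by apply: (@addrI _ (tproj_fun g 0 n')); rewrite -tproj_funDl !addr0.
have f0r m' : tproj_fun g m' 0 = 0.
  by apply: (@addrI _ (tproj_fun g m' 0)); rewrite -tproj_funDr !addr0.
elim/(grading_ind (gring_grading R)): r => [|r s hr hs|c r cr].
- by rewrite !scale0r f0l f0r.
- by rewrite !scalerDl tproj_funDl tproj_funDr hr hs.
elim/(grading_ind grM): m => [|x y hx hy|a m cm].
- by rewrite scaler0 !f0l.
- by rewrite scalerDr !tproj_funDl hx hy.
elim/(grading_ind grN): n => [|x y hx hy|b n cn].
- by rewrite scaler0 !f0r.
- by rewrite scalerDr !tproj_funDr hx hy.
rewrite (tproj_fun_hom _ (gmod_scale cr cm) cn) (tproj_fun_hom _ cm (gmod_scale cr cn)).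
have [_ _ ->] := pure_balanced M N.
by rewrite [c + a]addrC addrA.
Qed.

Lemma gtensor_grading : is_grading gtensor_comp.
Proof.
have c0 := gtensor_comp0; have cB := gtensor_compB.
pose p g := tlift (tproj_fun g) : tensor M N -> tensor M N.
have pD g x y : p g (x + y) = p g x + p g y by apply: tliftD; exact: tproj_balanced.
have p0 g : p g 0 = 0 by apply: (@addrI _ (p g 0)); rewrite -pD !addr0.
have pE g g' x : gtensor_comp g x -> p g' x = if g' == g then x else 0.
  move=> [s [-> hs]]; rewrite (big_morph _ (pD g') (p0 g')).
  rewrite (_ : (if _ then _ else _) =
     \sum_(p <- s) if g' == g then pure p.1 p.2 else 0); last first.
    by case: ifP => // _; rewrite big1.
  rewrite big_seq [RHS]big_seq; apply: eq_bigr => q /hs [a [b [<- ca cb]]].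
  by rewrite /p tlift_pure ?(tproj_fun_hom _ ca cb) //; exact: tproj_balanced.
apply: (@is_grading_proj _ _ _ c0 cB p) => //.
- elim/gtensor_gen => [|x y hx hy|a b m n cm cn].
  + exact: hsum0.
  + exact: hsumD.
  + exact: hsum_hcomp (gtensor_comp_pure cm cn).
- by move=> g x /pE ->; rewrite eqxx.
- by move=> g g' x /pE -> /negbTE ->.
Qed.

Lemma gtensor_tmap (c g : G) (u : M -> M) x :
  linear u -> (forall a m, gmod_comp a m -> gmod_comp (c + a) (u m)) ->
  gtensor_comp g x -> gtensor_comp (c + g) (tmap u id x).
Proof.
move=> lu du [s [-> hs]]; rewrite tmap_sum //.
apply: (hcomp_sum gtensor_comp0 gtensor_compB) => p /hs [a [b [<- ca cb]]].
by rewrite tmap_pure // addrA; apply: gtensor_comp_pure => //; exact: du.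
Qed.

Lemma gtensor_scale g g' (r : R) x :
  gring_comp g r -> gtensor_comp g' x -> gtensor_comp (g + g') (r *: x).
Proof.
move=> cr; apply: gtensor_tmap => //; first exact: scale_linear.
by move=> a m; exact: gmod_scale.
Qed.

Definition gtensor : gradedMod R := GradedMod gtensor_grading gtensor_scale.

End GradedTensor.

(* The map h is a parameter of restr so that the R-action can be inferred.   *)
Definition restr (R S : comPzRingType) (h : {rmorphism R -> S}) (N : lmodType S) :
  Type := N.

Section Restriction.
Variables (R S : comPzRingType) (h : {rmorphism R -> S}) (N : lmodType S).

Local Notation restr := (restr h N).

HB.instance Definition _ := GRing.Zmodule.on restr.

Definition restr_scale (r : R) (x : restr) : restr := h r *: (x : N).

Lemma restr_scaleA a b x : restr_scale a (restr_scale b x) = restr_scale (a * b) x.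
Proof. by rewrite /restr_scale scalerA rmorphM. Qed.

Lemma restr_scale1 : left_id 1 restr_scale.
Proof. by move=> x; rewrite /restr_scale rmorph1 scale1r. Qed.

Lemma restr_scaleDr : right_distributive restr_scale +%R.
Proof. by move=> a x y; exact: scalerDr. Qed.

Lemma restr_scaleDl x : {morph restr_scale^~ x : a b / a + b}.
Proof. by move=> a b; rewrite /restr_scale rmorphD; exact: scalerDl. Qed.

HB.instance Definition _ := GRing.Zmodule_isLmodule.Build R restr
  restr_scaleA restr_scale1 restr_scaleDr restr_scaleDl.

End Restriction.

Section ScalarFunctors.
Variables (G : zmodType) (R S : gradedRing G) (h : gringMor R S).

Lemma grestr_scale (N : gradedMod S) g g' (r : R) (x : restr h N) :
  gring_comp g r -> gmod_comp g' (x : N) -> gmod_comp (g + g') (r *: x : N).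
Proof. by move=> cr cx; apply: gmod_scale => //; exact: gringMor_deg. Qed.

(* h_*(N) *)
Definition grestr (N : gradedMod S) : gradedMod R :=
  @GradedMod G R (restr h N) (@gmod_comp G S N) (gmod_grading N) (@grestr_scale N).

(* h_*(S) *)
Definition grestr_ring : gradedMod R := grestr (gregular S).

Definition smul (s : S) (t : grestr_ring) : grestr_ring := s * (t : S).

Lemma smul_linear s : linear (smul s).
Proof.
move=> r x y; rewrite /smul.
by rewrite -[r *: x]/(h r * (x : S)) [LHS]mulrDr mulrCA.
Qed.

Lemma smulA a b x : smul a (smul b x) = smul (a * b) x.
Proof. exact: mulrA. Qed.

Lemma smul1 x : smul 1 x = x.
Proof. exact: mul1r. Qed.

Lemma smulDl a b x : smul (a + b) x = smul a x + smul b x.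
Proof. exact: mulrDl. Qed.

Lemma smul_deg g g' s (t : grestr_ring) :
  gring_comp g s -> gmod_comp g' t -> gmod_comp (g + g') (smul s t).
Proof. exact: gring_mul. Qed.

(* h^*(M): the underlying group is the tensor product of h_*(S) and M over   *)
(* R, and s acts by s (t (x) m) = (s t) (x) m.                               *)
Section Extension.
Variable M : gradedMod R.

Definition ext : Type := tensor grestr_ring M.
HB.instance Definition _ := GRing.Zmodule.on ext.
HB.instance Definition _ := GRing.Zmodule_isLmodule.Build S ext
  (@tactA R S grestr_ring M smul smul_linear smulA)
  (@tact1 R S grestr_ring M smul smul_linear smul1)
  (@tactDr R S grestr_ring M smul smul_linear)
  (@tactDl R S grestr_ring M smul smul_linear smulDl).

Lemma ext_scale_pure (s t : S) (m : M) :
  s *: (pure (t : grestr_ring) m : ext) = pure (s * t : grestr_ring) m :> ext.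
Proof. by apply: tact_pure; exact: smul_linear. Qed.

Definition ext_comp (g : G) : set ext := @gtensor_comp G R grestr_ring M g.

Lemma ext_scale g g' (s : S) (x : ext) :
  gring_comp g s -> ext_comp g' x -> ext_comp (g + g') (s *: x).
Proof.
move=> cs; apply: gtensor_tmap => //; first exact: smul_linear.
by move=> a m; exact: smul_deg.
Qed.

Definition gext : gradedMod S :=
  @GradedMod G S ext ext_comp (gtensor_grading grestr_ring M) ext_scale.

End Extension.

Section ExtensionMap.
Variables (M N : gradedMod R) (u : gmor M N).

Definition ext_map : gext M -> gext N := tmap (@id grestr_ring) u.

Lemma ext_map_gmor : is_gmor ext_map.
Proof.
have lu := (gmorP u).1; have li := @linear_id R grestr_ring.
have mD := tmapD li lu; have mp := tmap_pure li lu; have m0 := tmap0 li lu.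
have fD (x y : gext M) : ext_map (x + y) = ext_map x + ext_map y by exact: mD.
have f0 : ext_map 0 = 0 by exact: m0.
have fp t m : ext_map (pure t m) = pure t (u m) by exact: mp.
split=> [s x y|g x [r [-> hr]]].
  rewrite fD; congr (_ + _); elim/tensor_ind: x => [|x z hx hz|t m].
  - by rewrite scaler0 f0 scaler0.
  - by rewrite scalerDr fD hx hz -scalerDr -fD.
  - by rewrite ext_scale_pure !fp ext_scale_pure.
rewrite /ext_map tmap_sum //.
apply: (hcomp_sum (@gtensor_comp0 _ _ _ _) (@gtensor_compB _ _ _ _)).
move=> p /hr [a [b [<- ca cb]]]; rewrite mp; apply: gtensor_comp_pure => //.
exact: (gmorP u).2.
Qed.

Definition gext_map : gmor (gext M) (gext N) := mk_gmor ext_map_gmor.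

End ExtensionMap.

Definition extension : functor (gMod R) (gMod S).
Proof.
refine (@Functor (gMod R) (gMod S) gext gext_map _ _).
- move=> M; apply: gmorE => x; apply: esym.
  by apply: (tmap_unique (@linear_id R grestr_ring) (@linear_id R M)).
- move=> M N P u v; apply: gmorE => x; apply: esym.
  have li := @linear_id R grestr_ring.
  have lu := (gmorP u).1; have lv := (gmorP v).1.
  apply: (tmap_unique li (gmorP (gmor_comp u v)).1) => [y z|t m] /=.
  + by rewrite /ext_map (tmapD li lv) (tmapD li lu).
  + by rewrite /ext_map (tmap_pure li lv) (tmap_pure li lu).
Defined.

(* the coextension of M: the graded Hom from h_*(S) to M over R, where s     *)
(* acts by (s u)(t) = u (s t)                                                *)
Section Coextension.
Variable M : gradedMod R.

Definition coext : Type := gHom grestr_ring M.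
HB.instance Definition _ := GRing.Zmodule.on coext.

Lemma hsum_smul s : hsum (@hom_deg _ _ grestr_ring grestr_ring) (smul s).
Proof.
have c0 := @hom_deg0 _ _ grestr_ring grestr_ring.
have cB := @hom_degB _ _ grestr_ring grestr_ring.
elim/(grading_ind (gring_grading S)): s => [|r s hr hs|d s cs].
- rewrite (_ : smul 0 = 0); first exact: hsum0.
  by apply: funext => x; exact: mul0r.
- rewrite (_ : smul _ = smul r + smul s); first exact: hsumD.
  by apply: funext => x; exact: smulDl.
apply: (@hsum_hcomp _ _ _ c0 cB d) => //.
by split=> [|g x cx]; [exact: smul_linear | exact: smul_deg].
Qed.

Definition coext_scale (s : S) (u : coext) : coext :=
  mk_gHom (hsum_hom_comp (gHomP u) (hsum_smul s)).

Lemma coext_scaleA a b u : coext_scale a (coext_scale b u) = coext_scale (a * b) u.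
Proof. by apply: gHomE => t /=; rewrite smulA mulrC. Qed.

Lemma coext_scale1 : left_id 1 coext_scale.
Proof. by move=> u; apply: gHomE => t /=; rewrite smul1. Qed.

Lemma coext_scaleDr : right_distributive coext_scale +%R.
Proof. by move=> s u v; apply: gHomE. Qed.

Lemma coext_scaleDl u : {morph coext_scale^~ u : a b / a + b}.
Proof. by move=> a b; apply: gHomE => t /=; rewrite smulDl raddfD. Qed.

HB.instance Definition _ := GRing.Zmodule_isLmodule.Build S coext
  coext_scaleA coext_scale1 coext_scaleDr coext_scaleDl.

Lemma gcoext_scale g g' (s : S) (u : coext) :
  gring_comp g s -> gHom_comp g' u -> gHom_comp (g + g') (s *: u : coext).
Proof.
move=> cs cu; rewrite /gHom_comp /= [g + g']addrC.
apply: hom_deg_comp => //.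
by split=> [|a x cx]; [exact: smul_linear | exact: smul_deg].
Qed.

Definition gcoext : gradedMod S :=
  @GradedMod G S coext (@gHom_comp G R grestr_ring M)
    (gHom_grading grestr_ring M) gcoext_scale.

End Coextension.

Section CoextensionMap.
Variables (M N : gradedMod R) (u : gmor M N).

Lemma gmor_hom_deg : hom_deg 0 (u : M -> N).
Proof.
have [lu du] := gmorP u; split=> // g x cx.
by have := du g x cx; rewrite /= add0r.
Qed.

Lemma gmor_hsum : hsum (@hom_deg _ _ M N) u.
Proof.
by apply: hsum_hcomp gmor_hom_deg; [exact: hom_deg0 | exact: hom_degB].
Qed.

Definition coext_map (v : gcoext M) : gcoext N :=
  mk_gHom (hsum_hom_comp gmor_hsum (gHomP (v : gHom grestr_ring M))).

Lemma coext_map_gmor : is_gmor coext_map.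
Proof.
split=> [s v w|g v cv]; first by apply: gHomE => t /=; exact: raddfD.
by have := hom_deg_comp gmor_hom_deg cv; rewrite add0r.
Qed.

Definition gcoext_map : gmor (gcoext M) (gcoext N) := mk_gmor coext_map_gmor.

End CoextensionMap.

Definition coextension : functor (gMod R) (gMod S).
Proof.
by refine (@Functor (gMod R) (gMod S) gcoext gcoext_map _ _);
  intros; apply: gmorE => ?; apply: gHomE.
Defined.

End ScalarFunctors.

(* Main.v *)
(* A graded R-module P is projective of finite type iff it has a finite homogeneous dual basis:
   x = sum_i phi_i(x) e_i.  Let D be the coextension of R, i.e. Hom_R(S, R) as an S-module.

   From a dual basis of S: the coextension is D (x)_R -, with right adjoint N |-> Hom_S(D, N),
   and the extension S (x)_R - is Hom_R(D, -), with left adjoint N |-> D (x)_S N; both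
   adjunctions are given by explicit universal arrows built from sum_i e_i (x) phi_i.

   (ii) => (iii): let K be a graded submodule of the coextension of C.  If K contains the images
   of the coextensions of enough maps B -> C to cover C, then K is everything, since the
   projection modulo K and 0 have the same adjunct.  Taking for K the image of an epimorphism
   gives projectivity; taking for K the maps whose range lies in a finitely generated submodule
   of C = S, and looking at the identity of S, gives finite type.

   (i) => (iii): if A is the image of S under the left adjoint, the unit gives a point
   x0 = sum_i e_i (x) p_i of S (x) A through which every homogeneous s (x) 1 in S (x) R factors,
   by a unique homogeneous v_s : A -> R; then phi_i(s) = v_s(p_i) makes a dual basis. *)
From HB Require Import structures.
Require Import Defs.
From mathcomp Require Import all_boot all_algebra.
From mathcomp Require Import boolp classical_sets functions.

Set Implicit Arguments.
Unset Strict Implicit.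
Unset Printing Implicit Defensive.

(* Defs again: mathcomp's vector.v shadows [hom]. *)
Import GRing.Theory Defs.
Local Open Scope ring_scope.

(** * Graded submodules and their quotients *)

Section Submodule.
Variables (G : zmodType) (R : gradedRing G) (N : gradedMod R).

(* A graded submodule, given by its homogeneous components; the submodule itself is [hsum K]. *)
Record gsubmod := GSubmod {
  gsub_comp :> G -> set N;
  gsub0 : forall g, gsub_comp g 0;
  gsubB : forall g x y, gsub_comp g x -> gsub_comp g y -> gsub_comp g (x - y);
  gsub_sub : forall g x, gsub_comp g x -> gmod_comp g x;
  gsub_scale : forall g g' (r : R) x,
    gring_comp g r -> gsub_comp g' x -> gsub_comp (g + g') (r *: x) }.

Variable K : gsubmod.

Lemma hsum_gsubZ (r : R) x : hsum K x -> hsum K (r *: x).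
Proof.
have c0 := gsub0 K; have cB := @gsubB K.
move=> hx; elim/(grading_ind (gring_grading R)): r => [|r s hr hs|g r cr].
- by rewrite scale0r; exact: hsum0.
- by rewrite scalerDl; exact: hsumD.
elim/hsum_ind: hx => [|y z hy hz|g' y cy].
- by rewrite scaler0; exact: hsum0.
- by rewrite scalerDr; exact: hsumD.
exact: hsum_hcomp (gsub_scale cr cy).
Qed.

(** Lets the homogeneous projections of [N] descend to the quotient; it holds because elements of
    [hsum K] are sums of homogeneous elements of [K]. *)
Lemma gproj_gsub g x : hsum K x -> K g (gproj (gmod_grading N) g x).
Proof.
have c0 := gsub0 K; have cB := @gsubB K.
elim/hsum_ind => [|y z hy hz|g' y cy].
- by rewrite (gproj_hom _ _ (grading0 (gmod_grading N) g)) if_same.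
- by rewrite gprojD; exact: (hcompD c0 cB).
rewrite (gproj_hom _ _ (gsub_sub cy)); case: eqP => [->|_] //.
Qed.

Definition gsub_pred : {pred N} := fun x => `[< hsum K x >].

Lemma gsub_submod_closed : submod_closed gsub_pred.
Proof.
have c0 := gsub0 K; have cB := @gsubB K.
split=> [|r x y /asboolP hx /asboolP hy]; apply/asboolP; first exact: hsum0.
by apply: hsumD => //; exact: hsum_gsubZ.
Qed.

HB.instance Definition _ :=
  GRing.isSubmodClosed.Build R N gsub_pred gsub_submod_closed.

Definition gquot_sort : Type := Quotient.quot (gsub_pred : zmodClosed N).
HB.instance Definition _ := GRing.Zmodule.on gquot_sort.

Definition qpi (x : N) : gquot_sort := (\pi_(Quotient.quot (gsub_pred : zmodClosed N)) x)%qT.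

Lemma qpiB x y : qpi (x - y) = qpi x - qpi y.
Proof. exact: (raddfB \pi_(Quotient.quot (gsub_pred : zmodClosed N))%qT). Qed.

Lemma qpiD x y : qpi (x + y) = qpi x + qpi y.
Proof. exact: (raddfD \pi_(Quotient.quot (gsub_pred : zmodClosed N))%qT). Qed.

Lemma qpi0 : qpi 0 = 0.
Proof. exact: (raddf0 \pi_(Quotient.quot (gsub_pred : zmodClosed N))%qT). Qed.

Lemma qpi_eq x y : qpi x = qpi y <-> hsum K (x - y).
Proof.
split=> [/eqP|h].
  by rewrite -[_ == _]/(x == y %[mod Quotient.quot (gsub_pred : zmodClosed N)])%qT
    -Quotient.idealrBE => /asboolP.
apply/eqP; rewrite -[_ == _]/(x == y %[mod Quotient.quot (gsub_pred : zmodClosed N)])%qT.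
by rewrite -Quotient.idealrBE; apply/asboolP.
Qed.

Lemma qpi_repr (y : gquot_sort) : qpi (repr (y : Quotient.quot _)) = y.
Proof. exact: reprK. Qed.

Lemma qpi_ind (P : gquot_sort -> Prop) : (forall x, P (qpi x)) -> forall y, P y.
Proof. by move=> h y; rewrite -(qpi_repr y). Qed.

Definition qscale (r : R) (y : gquot_sort) : gquot_sort :=
  qpi (r *: repr (y : Quotient.quot _)).

Lemma qscale_pi r x : qscale r (qpi x) = qpi (r *: x).
Proof.
apply/qpi_eq; rewrite -scalerBr; apply: hsum_gsubZ; apply/qpi_eq.
by rewrite qpi_repr.
Qed.

Lemma qscaleA a b x : qscale a (qscale b x) = qscale (a * b) x.
Proof. by elim/qpi_ind: x => x; rewrite !qscale_pi scalerA. Qed.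

Lemma qscale1 : left_id 1 qscale.
Proof. by elim/qpi_ind => x; rewrite qscale_pi scale1r. Qed.

Lemma qscaleDr : right_distributive qscale +%R.
Proof.
move=> a; elim/qpi_ind => x; elim/qpi_ind => y.
by rewrite -qpiD !qscale_pi -qpiD scalerDr.
Qed.

Lemma qscaleDl x : {morph qscale^~ x : a b / a + b}.
Proof.
by elim/qpi_ind: x => x a b; rewrite /= !qscale_pi -qpiD scalerDl.
Qed.

HB.instance Definition _ := GRing.Zmodule_isLmodule.Build R gquot_sort
  qscaleA qscale1 qscaleDr qscaleDl.

Lemma qpiZ (r : R) x : qpi (r *: x) = r *: qpi x.
Proof. by rewrite -[RHS]/(qscale _ _) qscale_pi. Qed.

Definition gquot_comp (g : G) : set gquot_sort :=
  [set y | exists2 x, gmod_comp g x & y = qpi x].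

Lemma gquot_grading : is_grading gquot_comp.
Proof.
pose gr := gmod_grading N.
have c0 g : gquot_comp g 0 by exists 0; [exact: (grading0 gr) | rewrite qpi0].
have cB g x y : gquot_comp g x -> gquot_comp g y -> gquot_comp g (x - y).
  move=> [a ca ->] [b cb ->]; exists (a - b); first exact: (gradingB gr).
  by rewrite qpiB.
(* The projection of [N] is applied to a chosen representative; [pE] shows that the choice does not
   matter. *)
pose p g (y : gquot_sort) := qpi (gproj gr g (repr (y : Quotient.quot _))).
have pE g x : p g (qpi x) = qpi (gproj gr g x).
  apply/qpi_eq; have pr0 : gproj gr g 0 = 0.
    by rewrite (gproj_hom gr _ (grading0 gr g)) if_same.
  have pN z : gproj gr g (- z) = - gproj gr g z.
    by apply: (@addrI _ (gproj gr g z)); rewrite -gprojD !subrr.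
  rewrite -pN -gprojD; apply: hsum_hcomp (gproj_gsub g _); try exact: gsub0; try exact: gsubB.
  by apply/qpi_eq; rewrite qpi_repr.
apply: (@is_grading_proj _ _ _ c0 cB p).
- elim/qpi_ind; elim/(grading_ind gr) => [|x y hx hy|g x cx].
  + by rewrite qpi0; exact: hsum0.
  + by rewrite qpiD; exact: hsumD.
  + by apply: (hsum_hcomp c0 cB (g := g)); exists x.
- by move=> g; elim/qpi_ind => x; elim/qpi_ind => y; rewrite -qpiD !pE gprojD qpiD.
- by move=> g x [a ca ->]; rewrite pE gproj_id.
- by move=> g g' x [a ca ->] /negbTE gg'; rewrite pE (gproj_hom gr _ ca) gg' qpi0.
Qed.

Lemma gquot_scale g g' (r : R) y :
  gring_comp g r -> gquot_comp g' y -> gquot_comp (g + g') (r *: y).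
Proof.
by move=> cr [x cx ->]; exists (r *: x); [exact: gmod_scale | rewrite qpiZ].
Qed.

Definition gquot : gradedMod R := GradedMod gquot_grading gquot_scale.

Lemma qpi_gmor : is_gmor (qpi : N -> gquot).
Proof.
by split=> [a x y|g x cx]; [rewrite qpiD qpiZ | exists x].
Qed.

Definition gquot_pi : gmor N gquot := mk_gmor qpi_gmor.

Lemma gquot_pi_eq0 x : gquot_pi x = 0 <-> hsum K x.
Proof. by rewrite -[0]qpi0 -[x in hsum _ x]subr0; exact: qpi_eq. Qed.

Record gsub_sort := GSub { gsub_val :> N; gsub_subproof : gsub_val \in gsub_pred }.
HB.instance Definition _ := [isSub for gsub_val].
HB.instance Definition _ := [Choice of gsub_sort by <:].
HB.instance Definition _ := [SubChoice_isSubLmodule of gsub_sort by <:].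

Lemma gsub_grading : is_grading (fun g => [set x | K g (val x)]%classic : set gsub_sort).
Proof.
have c0 := gsub0 K; have cB := @gsubB K.
split.
- by move=> g; exact: c0.
- by move=> g x y; exact: cB.
- move=> [x hx]; have /asboolP[s [f [us cf xE]]] := hx.
  have hf g : f g \in gsub_pred by apply/asboolP; exact: hsum_hcomp (cf g).
  exists s, (fun g => GSub (hf g)); split => //.
  by apply: val_inj; rewrite [LHS]xE raddf_sum.
- move=> s f us cf f0 g gs; apply: val_inj.
  apply: (grading_direct (gmod_grading N) us _ _ gs (f := fun a => val (f a))).
    by move=> a; exact: gsub_sub (cf a).
  by rewrite -raddf_sum f0.
Qed.

Definition gsub : gradedMod R :=
  GradedMod gsub_grading (fun g g' r x cr => @gsub_scale K g g' r (val x) cr).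

Lemma gsub_val_gmor : is_gmor (gsub_val : gsub -> N).
Proof. by split=> [a x y|g x /gsub_sub]. Qed.

Definition gsub_incl : gmor gsub N := mk_gmor gsub_val_gmor.

Lemma gsub_incl_inj : injective gsub_incl.
Proof. exact: val_inj. Qed.

Lemma gsub_inclP x : hsum K x <-> exists y, x = gsub_incl y.
Proof.
split=> [/asboolP h|[[y /asboolP h] ->]] //.
by exists (GSub (h : x \in gsub_pred)).
Qed.

End Submodule.

(** * Images, kernels, epimorphisms and projectivity *)

Section Morphisms.
Variables (G : zmodType) (R : gradedRing G).
Implicit Types M N P : gradedMod R.

Lemma gprojP0 M g : gproj (gmod_grading M) g 0 = 0.
Proof. by rewrite (gproj_hom _ _ (grading0 (gmod_grading M) g)) if_same. Qed.

(** Used to replace arbitrary preimages by homogeneous ones of the right degree. *)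
Lemma gmor_gproj M N (u : gmor M N) g x :
  u (gproj (gmod_grading M) g x) = gproj (gmod_grading N) g (u x).
Proof.
elim/(grading_ind (gmod_grading M)): x => [|x y hx hy|g' x cx].
- by rewrite gprojP0 raddf0 gprojP0.
- by rewrite gprojD !raddfD /= gprojD hx hy.
rewrite (gproj_hom _ _ cx) (gproj_hom _ _ ((gmorP u).2 _ _ cx)).
by case: ifP; rewrite ?raddf0.
Qed.

Lemma gmor_ext M N (u v : gmor M N) :
  (forall g x, gmod_comp g x -> u x = v x) -> u = v.
Proof.
move=> h; apply: gmorE; elim/(grading_ind (gmod_grading M)) => //.
- by rewrite !raddf0.
- by move=> x y hx hy; rewrite !raddfD /= hx hy.
Qed.

Section Kernel.
Variables (M N : gradedMod R) (u : gmor M N).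

Definition gimage : gsubmod N.
Proof.
refine (@GSubmod _ _ N (fun g => [set y | exists2 x, gmod_comp g x & y = u x]%classic : set N) _ _ _ _).
- by move=> g; exists 0; [exact: grading0 (gmod_grading M) g | rewrite raddf0].
- move=> g _ _ [x cx ->] [y cy ->]; exists (x - y); last by rewrite raddfB.
  exact: (gradingB (gmod_grading M)).
- by move=> g _ [x cx ->]; exact: (gmorP u).2.
- move=> g g' r _ cr [x cx ->]; exists (r *: x); last by rewrite linearZ.
  exact: gmod_scale.
Defined.

Lemma hsum_gimage y : hsum gimage y <-> exists x, y = u x.
Proof.
split.
  elim/hsum_ind => [|a b [x ->] [x' ->]|g a [x _ ->]]; last by exists x.
  - by exists 0; rewrite raddf0.
  - by exists (x + x'); rewrite raddfD.
move=> [x ->]; elim/(grading_ind (gmod_grading M)): x => [|x z hx hz|g x cx].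
- by rewrite raddf0; exact: hsum0 (gsub0 gimage).
- by rewrite raddfD; exact: hsumD (gsub0 gimage) (@gsubB _ _ _ gimage) _ _ hx hz.
apply: (@hsum_hcomp _ _ _ (gsub0 gimage) (@gsubB _ _ _ gimage) g).
by exists x.
Qed.

Definition gker : gsubmod M.
Proof.
refine (@GSubmod _ _ M (fun g => [set x | gmod_comp g x /\ u x = 0]%classic : set M) _ _ _ _).
- by move=> g; split; [exact: grading0 (gmod_grading M) g | rewrite raddf0].
- move=> g x y [cx x0] [cy y0]; split; first exact: (gradingB (gmod_grading M)).
  by rewrite raddfB /= x0 y0 subrr.
- by move=> g x [].
- move=> g g' r x cr [cx x0]; split; first exact: gmod_scale.
  by rewrite linearZ /= x0 scaler0.
Defined.

(** Since [u] commutes with the homogeneous projections, each component of an element killed by [u]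
    is killed too. *)
Lemma hsum_gker x : hsum gker x <-> u x = 0.
Proof.
split.
  elim/hsum_ind => [|a b ha hb|g a [_ ->]] //; first by rewrite raddf0.
  by rewrite raddfD /= ha hb addr0.
move=> ux0; rewrite (gproj_sum (gmod_grading M) x).
apply: (hsum_sum (gsub0 gker) (@gsubB _ _ _ gker)) => g _.
apply: (@hsum_hcomp _ _ _ (gsub0 gker) (@gsubB _ _ _ gker) g); split.
  exact: gprojP.
by rewrite gmor_gproj ux0 gprojP0.
Qed.

End Kernel.

(** The projection onto the cokernel and the zero map agree after composition with [u], so the
    cokernel vanishes. *)
Lemma gmor_epi_surj M N (u : gmor M N) : @epi (gMod R) M N u -> forall y, exists x, u x = y.
Proof.
move=> eu y; have : gquot_pi (gimage u) = 0.
  apply: eu; apply: gmorE => x.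
  by apply/gquot_pi_eq0/hsum_gimage; exists x.
move=> /(congr1 (fun v : gmor _ _ => v y)) /gquot_pi_eq0 /hsum_gimage[x ->].
by exists x.
Qed.

Lemma gmor_surj_epi M N (u : gmor M N) : (forall y, exists x, u x = y) -> @epi (gMod R) M N u.
Proof.
move=> su P a b ab; apply: gmorE => y; have [x <-] := su y.
exact: (congr1 (fun v : gmor _ _ => v x) ab).
Qed.

(** Hom is always left exact, so only lifting along surjections is at stake. *)
Lemma projectiveP P : projective P <->
  forall M N (g : gmor M N), (forall y, exists x, g x = y) ->
  forall u : gmor P N, exists w, gmor_comp g w = u.
Proof.
split=> [pP M N g sg u|lP A B C f g [fi fg sg]].
  (* The inclusion of the kernel of [g] completes [g] to a short exact sequence. *)
  have [|_ _ lift] := pP _ _ _ (gsub_incl (gker g)) g; last exact: lift.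
  split=> // [|b]; first exact: gsub_incl_inj.
  exact: iff_trans (iff_sym (hsum_gker g b)) (gsub_inclP (gker g) b).
split.
- move=> u v uv; apply: gmorE => x; apply: fi.
  exact: (congr1 (fun w : gmor _ _ => w x) uv).
- move=> v; split=> [gv0|[a ->]]; last first.
    by apply: gmorE => x; apply/fg; exists (a x).
  have h x : exists y, v x = f y.
    by apply/fg; exact: (congr1 (fun w : gmor _ _ => w x) gv0).
  (* Preimages under the injective [f] are unique, so the chosen function is automatically linear
     and graded. *)
  have [a aE] := choice h.
  suff ha : is_gmor a by exists (mk_gmor ha); apply: gmorE => x; exact: aE.
  split=> [r x y|d x cx]; first by apply: fi; rewrite -aE !linearP /= -!aE.
  rewrite (_ : a x = gproj (gmod_grading A) d (a x)); first exact: gprojP.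
  by apply: fi; rewrite gmor_gproj -aE gproj_id //; exact: (gmorP v).2.
- by move=> u; exact: lP.
Qed.

(** The opposite degrees of [e i] and [phi i] make each term of the expansion of a homogeneous [x]
    homogeneous of the degree of [x]. *)
Definition has_dual_basis P := exists (I : finType) (d : I -> G) (e : I -> P)
    (phi : I -> gHom P (gregular R)),
  [/\ forall i, gmod_comp (d i) (e i), forall i, gHom_comp (- d i) (phi i)
    & forall x, x = \sum_i (phi i x : R) *: e i].

End Morphisms.

(** * Dual bases and projective modules of finite type *)

Section DualBasis.
Variables (G : zmodType) (R : gradedRing G).
Implicit Types M N P : gradedMod R.

Definition gHom_of_deg M N g (u : M -> N) (hu : hom_deg g u) : gHom M N :=
  mk_gHom (hsum_hcomp (@hom_deg0 _ _ M N) (@hom_degB _ _ M N) hu).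

Section FreeMap.
Variables (I : finType) (d : I -> G).

Lemma gcoord_deg i : hom_deg (d i) (fun x : gfree R d => x i : gregular R).
Proof. by split=> [a x y|g x cx]; [rewrite !ffunE | exact: cx]. Qed.

Definition gcoord i : gHom (gfree R d) (gregular R) := gHom_of_deg (gcoord_deg i).

Definition gunit i : gfree R d := [ffun j => if j == i then 1 else 0].

Lemma gunit_deg i : gmod_comp (- d i) (gunit i).
Proof.
move=> j; rewrite ffunE; case: eqP => [->|_]; last exact: (grading0 (gring_grading R)).
by rewrite /= subrr; exact: gring1.
Qed.

Lemma gunit_sum (x : gfree R d) : x = \sum_i (x i : R) *: gunit i.
Proof.
apply/ffunP => j; rewrite sum_ffunE (bigD1 j) //= big1 => [|i /negbTE ij].
  by rewrite !ffunE eqxx addr0 [RHS]mulr1.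
by rewrite !ffunE eq_sym ij [LHS]mulr0.
Qed.

Variables (M : gradedMod R) (e : I -> M).
Hypothesis ce : forall i, gmod_comp (- d i) (e i).

Lemma gfree_map_gmor : is_gmor (fun x : gfree R d => \sum_i (x i : R) *: e i).
Proof.
split=> [a x y|g x cx].
  rewrite scaler_sumr -big_split; apply: eq_bigr => i _ /=.
  by rewrite !ffunE scalerDl scalerA.
apply: (hcomp_sum (grading0 (gmod_grading M)) (gradingB (gmod_grading M))) => i _.
by have := gmod_scale (cx i) (ce i); rewrite /= addrAC subrr add0r.
Qed.

Definition gfree_map : gmor (gfree R d) M := mk_gmor gfree_map_gmor.

Lemma gfree_map_unit i : gfree_map (gunit i) = e i.
Proof.
rewrite /= (bigD1 i) //= big1 => [|j /negbTE ji].
  by rewrite !ffunE eqxx addr0 scale1r.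
by rewrite !ffunE ji scale0r.
Qed.

End FreeMap.

(** The generator of [R(- d i)] lies in degree [d i], whence the sign of the shifts. *)
Lemma finite_type_generated P (I : finType) (d : I -> G) (e : I -> P) :
  (forall i, gmod_comp (d i) (e i)) ->
  (forall x, exists c : I -> R, x = \sum_i c i *: e i) -> finite_type P.
Proof.
move=> ce eE; have ce' i : gmod_comp (- - d i) (e i) by rewrite opprK.
exists I, (fun i => - d i), (gfree R (fun i => - d i)), (gfree_map ce').
split; first by exists (gmor_id _), (gmor_id _); split; apply: gmorE.
apply: (@gmor_surj_epi _ _ _ _ (gfree_map ce')) => x; have [c ->] := eE x.
by exists [ffun i => c i]; apply: eq_bigr => i _; rewrite ffunE.
Qed.

Lemma dual_basisP P : has_dual_basis P <-> projective P /\ finite_type P.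
Proof.
split=> [[I [d [e [phi [ce cphi eE]]]]]|[/projectiveP pP [I [d [L [f [[k [k' [k'k _]]] ef]]]]]]].
  split.
  - apply/projectiveP => M N g sg u; have [b0 b0E] := choice sg.
    (* An arbitrary preimage need not give a graded lift. Its part of degree [d i] does, and still
       lies over [u (e i)], which is homogeneous of that degree. *)
    pose b i := gproj (gmod_grading M) (d i) (b0 (u (e i))).
    have gb i : g (b i) = u (e i).
      by rewrite gmor_gproj b0E gproj_id //; exact: (gmorP u).2.
    have hw : is_gmor (fun x => \sum_i (phi i x : R) *: b i).
      split=> [a x y|c x cx].
        rewrite scaler_sumr -big_split; apply: eq_bigr => i _ /=.
        by rewrite linearP scalerDl scalerA.
      apply: (hcomp_sum (grading0 (gmod_grading M)) (gradingB (gmod_grading M))) => i _.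
      have := gmod_scale ((cphi i).2 _ _ cx) (gprojP (gmod_grading M) (d i) (b0 (u (e i)))).
      by rewrite /= addrAC addNr add0r.
    exists (mk_gmor hw); apply: gmorE => x /=.
    rewrite raddf_sum [in RHS](eE x) raddf_sum; apply: eq_bigr => i _.
    by rewrite /= !linearZ /= gb.
  - by apply: (finite_type_generated ce) => x; exists (phi^~ x); exact: eE.
(* A section [w] of this surjection from a free module yields the dual basis: the images of the unit
   vectors, and the coordinates of [w]. *)
pose q : gmor (gfree R d) P := gmor_comp f k'.
have sq y : exists x, q x = y.
  have [x <-] := gmor_epi_surj ef y; exists (k x).
  have k'kx : (k' : gmor _ _) ((k : gmor _ _) x) = x :> L.
    exact: (congr1 (fun v : gmor L L => v x) k'k).
  by rewrite /= k'kx.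
have [w wE] := pP _ _ q sq (gmor_id P).
(* The unit vector of [R(d i)] lives in degree [- d i]. *)
exists I, (fun i => - d i), (fun i => q (gunit d i)).
exists (fun i => mk_gHom (hsum_hom_comp (gHomP (gcoord d i)) (gmor_hsum w))).
split=> [i|i|x]; first exact/(gmorP q).2/gunit_deg.
- rewrite opprK; have := hom_deg_comp (gcoord_deg d i) (gmor_hom_deg w).
  by rewrite addr0.
rewrite -[LHS](congr1 (fun v : gmor _ _ => v x) wE) /=.
rewrite [w x in LHS]gunit_sum -[f _]/(q _) raddf_sum; apply: eq_bigr => i _.
by rewrite /= -[f _]/(q _) linearZ.
Qed.

End DualBasis.

(** * Adjoint functors from universal arrows *)

Section Adjoints.
Variables C D : category.

(** The arrows [eps Y] become the counit and the factorization [tr] the adjunction bijection; [U] on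
    morphisms is forced by uniqueness, which also gives functoriality. *)
Lemma has_right_adjoint_universal (F : functor C D) :
  (forall Y : D, exists (X : C) (eps : hom (F X) Y), forall (X' : C) (u : hom (F X') Y),
     exists! v : hom X' X, u = compm eps (fmap F v)) ->
  has_right_adjoint F.
Proof.
move=> hF.
pose U Y := sval (cid (hF Y)); pose hU Y := svalP (cid (hF Y)).
pose eps Y : hom (F (U Y)) Y := sval (cid (hU Y)).
pose ueps Y : forall X (u : hom (F X) Y), exists! v, u = compm (eps Y) (fmap F v) :=
  svalP (cid (hU Y)).
pose tr X Y (u : hom (F X) Y) : hom X (U Y) := sval (cid (ueps Y X u)).
have trE X Y (u : hom (F X) Y) : u = compm (eps Y) (fmap F (tr X Y u)).
  by rewrite /tr; case: cid => v [].
have tr_uniq X Y (v : hom X (U Y)) : tr X Y (compm (eps Y) (fmap F v)) = v.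
  have [w [_ wu]] := ueps Y X (compm (eps Y) (fmap F v)).
  exact: etrans (esym (wu _ (trE _ _ _))) (wu v erefl).
pose Uf X Y (g : hom X Y) : hom (U X) (U Y) := tr _ _ (compm g (eps X)).
have Uf1 X : Uf X X (idm X) = idm (U X).
  by rewrite -[RHS]tr_uniq fmap1 compm1 /Uf comp1m.
have UfM X Y Z (f : hom Y Z) (g : hom X Y) :
    Uf X Z (compm f g) = compm (Uf Y Z f) (Uf X Y g).
  rewrite -[RHS]tr_uniq fmapM compmA -trE -!compmA -trE.
  by rewrite compmA.
exists (Functor Uf1 UfM); split.
apply: (@Adjunction _ _ F (Functor Uf1 UfM) tr) => [X Y|X X' Y Y' f g u].
  by exists (fun v => compm (eps Y) (fmap F v)) => v; rewrite -?trE ?tr_uniq.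
rewrite -[RHS]tr_uniq; congr (tr _ _ _).
have UfE : compm (eps Y') (fmap F (Uf Y Y' g)) = compm g (eps Y) := esym (trE _ _ _).
rewrite -[fmap (Functor _ _) g]/(Uf Y Y' g) !fmapM [RHS]compmA UfE -compmA.
by congr compm; rewrite compmA -trE.
Qed.

(** Dual construction, with the arrows [eta X] as unit; here the adjunction map is composition with
    [eta], and [tr] is its inverse. *)
Lemma has_left_adjoint_universal (U : functor D C) :
  (forall X : C, exists (Y : D) (eta : hom X (U Y)), forall (Y' : D) (u : hom X (U Y')),
     exists! v : hom Y Y', u = compm (fmap U v) eta) ->
  has_left_adjoint U.
Proof.
move=> hU.
pose F X := sval (cid (hU X)); pose hF X := svalP (cid (hU X)).
pose eta X : hom X (U (F X)) := sval (cid (hF X)).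
pose ueta X : forall Y (u : hom X (U Y)), exists! v, u = compm (fmap U v) (eta X) :=
  svalP (cid (hF X)).
pose tr X Y (u : hom X (U Y)) : hom (F X) Y := sval (cid (ueta X Y u)).
have trE X Y (u : hom X (U Y)) : compm (fmap U (tr X Y u)) (eta X) = u.
  by rewrite /tr; case: cid => v [].
have tr_uniq X Y (v : hom (F X) Y) : tr X Y (compm (fmap U v) (eta X)) = v.
  have [w [_ wu]] := ueta X Y (compm (fmap U v) (eta X)).
  exact: etrans (esym (wu _ (esym (trE _ _ _)))) (wu v erefl).
pose Ff X Y (g : hom X Y) : hom (F X) (F Y) := tr _ _ (compm (eta Y) g).
have Ff1 X : Ff X X (idm X) = idm (F X).
  by rewrite -[RHS]tr_uniq fmap1 comp1m /Ff compm1.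
have FfM X Y Z (f : hom Y Z) (g : hom X Y) :
    Ff X Z (compm f g) = compm (Ff Y Z f) (Ff X Y g).
  by rewrite -[RHS]tr_uniq fmapM -compmA trE compmA trE -compmA.
exists (Functor Ff1 FfM); split.
apply: (@Adjunction _ _ (Functor Ff1 FfM) U
  (fun X Y v => compm (fmap U v) (eta X))) => [X Y|X X' Y Y' f g u].
  by exists (tr X Y) => v; rewrite ?trE ?tr_uniq.
by rewrite !fmapM -!compmA trE.
Qed.

End Adjoints.

(** * Functors with a right adjoint and jointly covering maps *)

Section LeftAdjoint.
Variables (G : zmodType) (R S : gradedRing G) (F : functor (gMod R) (gMod S)).

(* The projection modulo [K] and the zero map have the same adjunct, as they agree on the
   [F B] and the maps [i] jointly cover [C]. *)
Lemma left_adjoint_cover (C : gradedMod R) (K : gsubmod (F C : gradedMod S)) :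
  has_right_adjoint F ->
  (forall g (x : C), gmod_comp g x -> exists (B : gradedMod R) (i : gmor B C),
     (exists y, x = i y) /\
     forall z, hsum K ((@fmap _ _ F B C i : gmor _ _) z)) ->
  forall z, hsum K z.
Proof.
move=> [U [[tr tr_bij tr_nat]]] hK.
pose q : @hom (gMod S) (F C) (gquot K) := gquot_pi K.
pose o : @hom (gMod S) (F C) (gquot K) := 0 : gmor _ _.
suff qo : q = o.
  move=> z; apply/gquot_pi_eq0.
  exact: (congr1 (fun u : gmor _ _ => u z) qo).
apply: (bij_inj (tr_bij _ _)); apply: gmor_ext => g x cx.
have [B [i [[y ->] hi]]] := hK g x cx.
have E : compm q (fmap F (i : @hom (gMod R) B C)) = compm o (fmap F (i : @hom (gMod R) B C)).
  by apply: gmorE => z; apply/gquot_pi_eq0; exact: hi.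
have trc u : compm (tr C (gquot K) u) (i : @hom (gMod R) B C) =
    tr B (gquot K) (compm u (fmap F (i : @hom (gMod R) B C))).
  have := tr_nat _ _ _ _ (i : @hom (gMod R) B C) (idm (gquot K : gMod S)) u.
  by rewrite comp1m fmap1 comp1m.
exact: (congr1 (fun u : gmor B _ => u y)
  (etrans (trc q) (etrans (congr1 _ E) (esym (trc o))))).
Qed.

End LeftAdjoint.

(** * From a right adjoint of the coextension to projectivity and finite type *)

Section CoextensionRightAdjoint.
Variables (G : zmodType) (R S : gradedRing G) (h : gringMor R S).
Hypothesis hra : has_right_adjoint (coextension h).

(** [left_adjoint_cover] makes the coextension of [g] surjective; read as a degree 0 element of the
    coextension of [N], [u] then lifts. *)
Lemma coextension_ra_projective : projective (grestr_ring h).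
Proof.
apply/projectiveP => M N g sg u.
have u0 := gmor_hom_deg u.
pose K : gsubmod (gcoext h N) := gimage (gcoext_map h g).
have hK : forall z, hsum K z.
  apply: (@left_adjoint_cover _ _ _ (coextension h) N K hra) => a x cx.
  exists M, g; split; first by have [y <-] := sg x; exists y.
  by move=> z; apply/hsum_gimage; exists z.
have /hsum_gimage [w wE] := hK (gHom_of_deg u0 : gcoext h N).
(* The preimage [w] need not be homogeneous; its degree 0 part still lies over [u] and is a graded
   morphism. *)
pose gr := gmod_grading (gcoext h M); pose w0 := gproj gr 0 w.
have w0E : gcoext_map h g w0 = gHom_of_deg u0 :> gcoext h N.
  by rewrite gmor_gproj -wE gproj_id.
have [lw dw] := gprojP gr 0 w.
have hw0 : is_gmor (w0 : grestr_ring h -> M).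
  by split=> // b x /dw; rewrite /= add0r.
exists (mk_gmor hw0); apply: gmorE => x.
exact: (congr1 (fun v : gHom _ _ => v x) w0E).
Qed.

Lemma coextension_ra_finite_type : finite_type (grestr_ring h).
Proof.
pose P := grestr_ring h.
(* The values of [f] lie in one finitely generated graded submodule. *)
pose bounded (f : gcoext h P) := exists (I : finType) (d : I -> G) (e : I -> P),
  (forall i, gmod_comp (d i) (e i)) /\
  forall x, exists c : I -> R, f x = \sum_i c i *: e i.
have bounded0 : bounded 0.
  exists void, (fun=> 0), (fun=> 0); split=> [[]|x].
  by exists (fun=> 0); rewrite big1 // => -[].
have boundedD f g : bounded f -> bounded g -> bounded (f + g).
  move=> [I [d [e [ce he]]]] [I' [d' [e' [ce' he']]]].
  exists (I + I')%type, (fun i => match i with inl i => d i | inr i => d' i end),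
    (fun i => match i with inl i => e i | inr i => e' i end); split=> [[]//|x].
  have [c cE] := he x; have [c' cE'] := he' x.
  exists (fun i => match i with inl i => c i | inr i => c' i end).
  by rewrite big_sumType -cE -cE'.
have boundedN f : bounded f -> bounded (- f).
  move=> [I [d [e [ce he]]]]; exists I, d, e; split=> // x; have [c cE] := he x.
  exists (fun i => - c i); rewrite -[LHS]/(- f x) cE -sumrN.
  by apply: eq_bigr => i _; rewrite scaleNr.
(* [s] acts by precomposition, so the range does not grow. *)
have boundedM f (s : S) : bounded f -> bounded (s *: f).
  by move=> [I [d [e [ce he]]]]; exists I, d, e; split=> // x; exact: he.
pose c (g : G) : set (gcoext h P) :=
  (fun f => gmod_comp g f /\ bounded f).
have c0 g : c g 0.
  by split; [exact: grading0 (gmod_grading (gcoext h P)) g | exact: bounded0].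
have cB g x y : c g x -> c g y -> c g (x - y).
  move=> [cx bx] [cy by_]; split; last by apply: boundedD => //; exact: boundedN.
  exact: (gradingB (gmod_grading (gcoext h P))).
have cZ g g' (s : S) x : gring_comp g s -> c g' x -> c (g + g') (s *: x).
  by move=> cs [cx bx]; split; [exact: gmod_scale | exact: boundedM].
have cS g x : c g x -> gmod_comp g x by case.
pose K : gsubmod (gcoext h P) := GSubmod c0 cB cS cZ.
have hK : forall z, hsum K z.
  apply: (@left_adjoint_cover _ _ _ (coextension h) P K hra) => a x cx.
  (* A homogeneous [x] of degree [a] is the image of the generator of [R(- a)], and the coextension
     of this map produces only maps with values in the multiples of [x]. *)
  have cx' (i : unit) : gmod_comp (- - a) x by rewrite opprK.
  pose i : gmor _ P := gfree_map (e := fun=> x) cx'.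
  exists (gfree R (fun _ : unit => - a)), i; split.
    by exists (gunit R (fun=> - a) tt); rewrite gfree_map_unit.
  move=> z; rewrite -[fmap _ _]/(gcoext_map h i).
  elim/(grading_ind (gmod_grading (gcoext h (gfree R (fun _ : unit => - a))))): z.
  + by rewrite raddf0; exact: hsum0.
  + by move=> y z hy hz; rewrite raddfD; exact: hsumD.
  move=> g z cz; apply: (hsum_hcomp c0 cB (g := g)); split.
    exact: (gmorP (gcoext_map h i)).2.
  exists unit, (fun=> a), (fun=> x); split=> // t.
  by exists (fun j => (z : gHom _ _) t j).
have {hK} : forall f, bounded f.
  move=> f; elim/hsum_ind: (hK f) => [|x y hx hy|g x []//]; first exact: bounded0.
  exact: boundedD.
(* For the identity of [S], boundedness means that [S] itself is finitely generated. *)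
move=> /(_ (gHom_of_deg (gmor_hom_deg (gmor_id P)))) [I [d [e [ce he]]]].
exact: (finite_type_generated ce he).
Qed.

End CoextensionRightAdjoint.

(** * From a left adjoint of the extension to a dual basis *)

Section ExtensionLeftAdjoint.
Variables (G : zmodType) (R S : gradedRing G) (h : gringMor R S).

Local Notation P := (grestr_ring h).

Lemma gext_map_sum (A M : gradedMod R) (v : gmor A M) (I : eqType) (r : seq I)
    (p : I -> P * A) :
  gext_map h v (\sum_(i <- r) pure (p i).1 (p i).2 : tensor P A) =
  (\sum_(i <- r) pure (p i).1 (v (p i).2) : tensor P M).
Proof.
have li := @linear_id R P; have lv := (gmorP v).1.
rewrite [LHS](tmap_sum li lv); apply: eq_bigr => i _; exact: tmap_pure.
Qed.

(* By the adjunction, a point x of degree 0 of h^*(M) is the same as a morphism A -> M. *)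
Lemma extension_la_universal_point : has_left_adjoint (extension h) ->
  exists (A : gradedMod R) (x0 : gext h A), gmod_comp 0 x0 /\
    forall (M : gradedMod R) (x : gext h M), gmod_comp 0 x ->
      exists! v : gmor A M, gext_map h v x0 = x.
Proof.
move=> [L [[tr tr_bij tr_nat]]].
pose A : gradedMod R := L (gregular S).
(* The unit of the adjunction at [S]; being [S]-linear, it is determined by its value [x0] at 1. *)
pose eta : gmor (gregular S) (gext h A) := tr (gregular S) A (idm (A : gMod R)).
pose x0 := eta (1 : S).
have trE (M : gradedMod R) (v : gmor A M) :
    tr (gregular S) M v = gmor_comp (gext_map h v) eta.
  have := tr_nat _ _ _ _ (idm (gregular S : gMod S)) (v : @hom (gMod R) A M)
    (idm (A : gMod R)).
  by rewrite fmap1 !compm1.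
exists A, x0; split; first exact: ((gmorP eta).2 _ _ (gring1 S)).
move=> M x cx.
have hu : is_gmor (fun s : gregular S => (s : S) *: x).
  split=> [a s t|g s cs]; first by rewrite scalerDl -scalerA.
  by have := gmod_scale cs cx; rewrite addr0.
have [w wK Kw] := tr_bij (gregular S) M.
pose v : gmor A M := w (mk_gmor hu).
have vE : gmor_comp (gext_map h v) eta = mk_gmor hu by rewrite -trE; exact: Kw.
exists v; split.
  exact: etrans (congr1 (fun f : gmor (gregular S) (gext h M) => f (1 : S)) vE) (scale1r x).
move=> v' v'E; apply: (bij_inj (tr_bij (gregular S) M)).
rewrite [LHS]trE [RHS]trE vE; apply: gmorE => s.
have etaE : eta s = (s : S) *: x0.
  by rewrite -[RHS](linearZ_LR eta) [_ *: _]mulr1.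
rewrite -[RHS]/(gext_map h v' (eta s)) etaE linearZ_LR.
exact: (congr1 (fun z : gext h M => (s : S) *: z) (esym v'E)).
Qed.

Lemma extension_la_dual_basis :
  has_left_adjoint (extension h) -> has_dual_basis P.
Proof.
move=> /extension_la_universal_point [A [x0 [cx0 univ]]]; have [s [x0E cs]] := cx0.
pose p (i : 'I_(size s)) : P * A := tnth (in_tuple s) i.
have {}x0E : x0 = \sum_i pure (p i).1 (p i).2.
  by rewrite x0E big_tnth.
(* As [x0] has degree 0, the two entries of each [p i] have opposite degrees. *)
have /choice [a ca] i : exists a, gmod_comp a (p i).1 /\ gmod_comp (- a) (p i).2.
  have [a [b [ab ca cb]]] := cs _ (mem_tnth i (in_tuple s)).
  by exists a; split => //; rewrite -(addKr a b) ab addr0 in cb.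
(* The image of [x0] under the map induced by [f], written out so that [f] may have any degree. *)
pose T (f : A -> gregular R) : tensor P (gregular R) := \sum_i pure (p i).1 (f (p i).2).
have [pDl pDr pZ] := pure_balanced P (gregular R).
(* The element 1 has degree [- g] in [R(g)], so over [R(g)] the degree [g] part of [t], tensored
   with 1, has degree 0 and the universal property applies. *)
have T_ex g (t : S) : exists f, hom_deg g f /\ T f = @pure R P (gregular R) (gproj (gring_grading S) g t) (1 : R).
  have cg : gmod_comp (- g) (1 : gshift (gregular R) g).
    by rewrite /= subrr; exact: gring1.
  have ct : @gmod_comp _ _ P g (gproj (gring_grading S) g t) by exact: gprojP.
  have := gtensor_comp_pure ct cg; rewrite subrr => ct0.
  have [v [vE _]] := univ (gshift (gregular R) g) _ ct0.
  exists v; split; first exact: gmorP.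
  by rewrite -[RHS]vE x0E gext_map_sum.
(* Maps of degree [g] are graded morphisms into [R(g)], where the uniqueness half of the universal
   property applies. *)
have T_inj g f f' : hom_deg g f -> hom_deg g f' -> T f = T f' -> f =1 f'.
  move=> hf hf' ff'.
  pose v := mk_gmor (hf : is_gmor (f : A -> gshift (gregular R) g)).
  pose v' := mk_gmor (hf' : is_gmor (f' : A -> gshift (gregular R) g)).
  have cx : gmod_comp 0 (gext_map h v x0).
    exact: ((gmorP (gext_map h v)).2 _ _ cx0).
  have [w [_ wu]] := univ _ _ cx.
  have wv : w = v by exact: wu.
  have wv' : w = v' by apply: wu; rewrite x0E !gext_map_sum.
  by move=> x; rewrite -[f x]/(v x) -wv wv'.
(* The map attached to the degree [g] part of [t]. Through [T_inj], identities in the tensor product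
   become additivity and [R]-linearity in [t]. *)
pose V g t := sval (cid (T_ex g t)).
have V_deg g t : hom_deg g (V g t) by rewrite /V; case: cid => f [].
have TV g t : T (V g t) = @pure R P (gregular R) (gproj (gring_grading S) g t) (1 : R).
  by rewrite /V; case: cid => f [].
have TD f f' : T (f + f') = T f + T f'.
  by rewrite /T -big_split; apply: eq_bigr => i _; exact: pDr.
have TZ (r : R) f : T (fun x => r *: f x) = r *: T f.
  rewrite /T scaler_sumr; apply: eq_bigr => i _.
  rewrite -pZ; apply: esym; apply: tact_pure; exact: scale_linear.
have VD x g t t' : V g (t + t') x = V g t x + V g t' x.
  apply: (T_inj g (V g (t + t')) (V g t + V g t')) => //.
    have := hcompD (@hom_deg0 _ _ A (gregular R)) (@hom_degB _ _ A (gregular R)).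
    by apply.
  by rewrite TD !TV gprojD; exact: pDl.
have VZ x g g' (r : R) t : gring_comp g' r -> gring_comp g t ->
    V (g' + g) (h r * t) x = r *: V g t x.
  move=> cr ct; apply: (T_inj (g' + g) _ (fun x => r *: V g t x)) => //.
    have [lV dV] := V_deg g t; split=> [b y z|c y cy].
      by rewrite lV scalerDr !scalerA mulrC.
    by have := gmod_scale cr (dV _ _ cy); rewrite /= addrA [g + g']addrC.
  rewrite TZ !TV !gproj_id //; last by apply: gring_mul => //; exact: gringMor_deg.
  by apply: esym; apply: tact_pure; exact: scale_linear.
(* For [t] homogeneous of degree [g] this is [V g t] at the second entry of [p i]; it is extended
   additively over the components. *)
pose phi i (t : P) : gregular R :=
  gfold (gring_grading S) (fun g t => V g t (p i).2) (t : S).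
have phiD i t t' : phi i (t + t') = phi i t + phi i t' by apply: gfoldD => g; exact: VD.
have phi0 i : phi i 0 = 0 by apply: (@addrI _ (phi i 0)); rewrite -phiD !addr0.
have phiE i g t : gring_comp g (t : S) -> phi i t = V g t (p i).2.
  by move=> ct; apply: gfold_hom => // g'; exact: VD.
have phi_deg i : hom_deg (- a i) (phi i).
  split=> [r t t'|g t ct]; last first.
    by have := (V_deg g t).2 _ _ (ca i).2; rewrite /= -(phiE _ _ _ ct) addrC.
  rewrite phiD; congr (_ + _).
  elim/(grading_ind (gring_grading R)): r => [|r r' hr hr'|c r cr].
  - by rewrite !scale0r phi0.
  - by rewrite !scalerDl phiD hr hr'.
  elim/(grading_ind (gring_grading S)): t => [|t u ht hu|g t ct].
  - by rewrite scaler0 phi0 scaler0.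
  - by rewrite scalerDr !phiD scalerDr ht hu.
  rewrite (phiE _ _ _ ct) -(VZ _ _ _ _ _ cr ct); apply: phiE.
  by apply: gring_mul => //; exact: gringMor_deg.
exists 'I_(size s), a, (fun i => (p i).1), (fun i => gHom_of_deg (phi_deg i)).
split=> [i|i|t]; [exact: (ca i).1 | exact: phi_deg|].
elim/(grading_ind (gring_grading S)): t => [|t u ht hu|g t ct].
- by rewrite big1 // => i _; rewrite raddf0 scale0r.
- rewrite {1}ht {1}hu -big_split; apply: eq_bigr => i _ /=.
  by rewrite phiD scalerDl.
(* Multiplication sends [t (x) 1] to [t]; applied to [TV] it gives the dual basis expansion of a
   homogeneous [t]. *)
pose k (t : P) (r : gregular R) : P := (r : R) *: t.
have kb : balanced k.
  split=> [m m' n|m n n'|r m n]; rewrite /k ?scalerDr ?scalerDl // scalerA mulrC //.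
have := congr1 (tlift k) (TV g t).
rewrite tlift_pure // gproj_id // /k scale1r => {1}<-.
have k0 : tlift k 0 = 0 by apply: (@addrI _ (tlift k 0)); rewrite -tliftD // !addr0.
rewrite /T (big_morph (tlift k) (fun x y => tliftD x y kb) k0).
by apply: eq_bigr => i _; rewrite tlift_pure //= (phiE _ _ _ ct).
Qed.

End ExtensionLeftAdjoint.

(** * From a dual basis to both adjoints *)

Section DualBasisAdjoints.
Variables (G : zmodType) (R S : gradedRing G) (h : gringMor R S).

Local Notation P := (grestr_ring h).
Local Notation D := (gcoext h (gregular R)).

Lemma gHom_sumE (A : gradedRing G) (M N : gradedMod A) (J : Type) (r : seq J)
    (F : J -> gHom M N) x : (\sum_(j <- r) F j) x = \sum_(j <- r) F j x.
Proof.
rewrite -[LHS]/(val (\sum_(j <- r) F j) x).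
by rewrite raddf_sum fct_sumE.
Qed.

Lemma coext_scaleE (M : gradedMod R) (s : S) (f : gcoext h M) t :
  (s *: f : gcoext h M) t = f (smul s t).
Proof. by []. Qed.

Variables (I : finType) (d : I -> G) (e : I -> P) (phi : I -> D).
Hypotheses (ce : forall i, gmod_comp (d i) (e i))
  (cphi : forall i, gmod_comp (- d i) (phi i))
  (eE : forall x, x = \sum_i (phi i x : R) *: e i).

(** Apply [f] to the expansion of [t]: evaluations at the [e i] are coordinates with respect to the
    [phi i]. The factor [h] expresses the [R]-action on [D]. *)
Lemma dual_eE (f : D) : f = \sum_i h (f (e i) : R) *: phi i.
Proof.
apply: gHomE => t; rewrite gHom_sumE {1}(eE t) raddf_sum; apply: eq_bigr => i _.
rewrite -[RHS]/(phi i (_ *: t)) linearZ /= linearZ; exact: mulrC.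
Qed.

(* The canonical element sum_i e_i (x) phi_i is S-central. *)
Lemma dual_basis_central (W : zmodType) (b : P -> grestr h D -> W) (s : S) :
  balanced b ->
  \sum_i b (smul s (e i)) (phi i) = \sum_i b (e i) (s *: phi i : D).
Proof.
move=> bb; have [bDl bDr bZ] := bb.
have bsl (F : I -> P) y : b (\sum_i F i) y = \sum_i b (F i) y.
  exact: (big_morph (b^~ y) (fun x x' => bDl x x' y) (balanced0l y bb)).
have b0r x : b x 0 = 0 by apply: (@addrI _ (b x 0)); rewrite -bDr !addr0.
have bsr (F : I -> grestr h D) x : b x (\sum_i F i) = \sum_i b x (F i).
  exact: (big_morph (b x) (bDr x) (b0r x)).
(* Expand [s e_i] in the [e j] and exchange the sums; the inner sum is the expansion of [s phi_j] by
   [dual_eE], since [(s phi_j)(e_i) = phi_j(s e_i)]. *)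
transitivity (\sum_i \sum_j b (e j) ((phi j (smul s (e i)) : R) *: (phi i : grestr h D))).
  apply: eq_bigr => i _; rewrite [smul s (e i) in LHS]eE bsl.
  by apply: eq_bigr => j _; rewrite bZ.
rewrite exchange_big; apply: eq_bigr => j _ /=.
by rewrite [s *: phi j]dual_eE -bsr.
Qed.

(** * The right adjoint of the coextension, Hom over [S] out of [D] *)

Section RightAdjoint.
Variable N : gradedMod S.

Definition coind : gradedMod R := grestr h (gHom_gmod D N).

(** The counit: [f], viewed as a pairing of [P] with [D], evaluated at the canonical element. *)
Definition coind_eval (f : gcoext h coind) : N := \sum_i (f (e i) : gHom D N) (phi i).

Lemma coind_balanced (f : gcoext h coind) :
  balanced (fun (t : P) (x : grestr h D) => (f t : gHom D N) x).
Proof.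
split=> [t t' x|t x x'|r t x].
- by rewrite raddfD.
- exact: (raddfD (f t : gHom D N)).
- rewrite [f _]linearZ_LR; exact: esym (linearZ_LR (f t : gHom D N) (h r) x).
Qed.

Lemma coind_eval_add : {morph coind_eval : x y / x + y}.
Proof. by move=> x y; rewrite /coind_eval -big_split. Qed.

(** Centrality of the canonical element moves [s] from [e i] to [phi i], and [f (e i)] is
    [S]-linear. *)
Lemma coind_eval_scale (s : S) f : coind_eval (s *: f) = s *: coind_eval f.
Proof.
rewrite /coind_eval scaler_sumr.
transitivity (\sum_i (f (smul s (e i)) : gHom D N) (phi i)).
  by apply: eq_bigr => i _; rewrite coext_scaleE.
rewrite (dual_basis_central s (coind_balanced f)); apply: eq_bigr => i _.
exact: (linearZ_LR (f (e i) : gHom D N)).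
Qed.

Lemma coind_eval_gmor : is_gmor coind_eval.
Proof.
split=> [s f f'|g f cf]; first by rewrite coind_eval_add coind_eval_scale.
apply: (hcomp_sum (grading0 (gmod_grading N)) (gradingB (gmod_grading N))) => i _.
by have := (cf.2 _ _ (ce i)).2 _ _ (cphi i); rewrite /= addrK.
Qed.

Variable M : gradedMod R.

Lemma gscal_deg g (m : M) : gmod_comp g m ->
  hom_deg g (fun r : gregular R => (r : R) *: m).
Proof.
move=> cm; split=> [a x y|g' r cr]; first by rewrite scalerDl -scalerA.
by rewrite /= addrC; exact: gmod_scale.
Qed.

Lemma hsum_gscal (m : M) :
  hsum (@hom_deg _ _ (gregular R) M) (fun r : gregular R => (r : R) *: m).
Proof.
have c0 := @hom_deg0 _ _ (gregular R) M; have cB := @hom_degB _ _ (gregular R) M.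
elim/(grading_ind (gmod_grading M)): m => [|m n hm hn|g m cm].
- rewrite (_ : (fun _ => _) = 0); first exact: hsum0.
  by apply: funext => r; exact: scaler0.
- rewrite (_ : (fun _ => _) = (fun r : gregular R => (r : R) *: m : M)
      + (fun r : gregular R => (r : R) *: n : M)); first exact: hsumD.
  by apply: funext => r; exact: scalerDr.
- exact: hsum_hcomp (gscal_deg cm).
Qed.

(** The rank one map [t |-> f(t) m], standing for [m (x) f]; by [dyad_sum] such maps generate the
    coextension. *)
Definition dyad (m : M) (f : D) : gcoext h M :=
  mk_gHom (hsum_hom_comp (hsum_gscal m) (gHomP (f : gHom P (gregular R)))).

Lemma dyad_deg g (m : M) : gmod_comp g m -> hom_deg g (dyad m).
Proof.
move=> cm; split=> [s f f'|g' f cf]; first by apply: gHomE => t; exact: scalerDl.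
exact: (hom_deg_comp (gscal_deg cm) cf).
Qed.

Lemma dyadD m m' f : dyad (m + m') f = dyad m f + dyad m' f.
Proof. by apply: gHomE => t; exact: scalerDr. Qed.

Lemma dyadZ (r : R) m f : dyad (r *: m) f = h r *: dyad m f.
Proof.
apply: gHomE => t; rewrite -[RHS]/(f (r *: t) *: m) linearZ /=.
by rewrite scalerA mulrC.
Qed.

Lemma dyad_sum (f : gcoext h M) : f = \sum_i dyad (f (e i)) (phi i).
Proof.
apply: gHomE => t; rewrite gHom_sumE {1}(eE t) raddf_sum; apply: eq_bigr => i _.
by rewrite /= linearZ.
Qed.

Lemma hsum_dyad m : hsum (@hom_deg _ _ D (gcoext h M)) (dyad m).
Proof.
have c0 := @hom_deg0 _ _ D (gcoext h M); have cB := @hom_degB _ _ D (gcoext h M).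
elim/(grading_ind (gmod_grading M)): m => [|m n hm hn|g m cm].
- rewrite (_ : dyad 0 = 0); first exact: hsum0.
  by apply: funext => f; apply: gHomE => t; exact: scaler0.
- rewrite (_ : dyad _ = (dyad m : D -> gcoext h M) + (dyad n : D -> gcoext h M)).
    exact: hsumD.
  by apply: funext => f; exact: dyadD.
- exact: hsum_hcomp (dyad_deg cm).
Qed.

Variable u : gmor (gcoext h M) N.

(** The transpose of [u], curried along the dyads: [m |-> (f |-> u (dyad m f))]. *)
Definition coind_adj (m : M) : coind :=
  mk_gHom (hsum_hom_comp (gmor_hsum u) (hsum_dyad m)).

Lemma coind_adj_gmor : is_gmor coind_adj.
Proof.
split=> [r m m'|g m cm].
  apply: gHomE => f; rewrite -[LHS]/(u (dyad (r *: m + m') f)).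
  by rewrite dyadD dyadZ linearP.
by have := hom_deg_comp (gmor_hom_deg u) (dyad_deg cm); rewrite add0r.
Qed.

(** Existence holds since every [f] is a sum of dyads; uniqueness since the composite with the
    counit, at [dyad m f], recovers [v m f] by [dual_eE]. *)
Lemma coind_universal : exists! v : gmor M coind,
  u = gmor_comp (mk_gmor coind_eval_gmor) (gcoext_map h v).
Proof.
exists (mk_gmor coind_adj_gmor); split.
  apply: gmorE => f; rewrite [f in LHS]dyad_sum raddf_sum; exact: eq_bigr.
move=> v uE; apply: gmorE => m; apply: gHomE => f.
rewrite -[LHS]/(u (dyad m f)) uE.
rewrite -[LHS]/(\sum_i (v ((f (e i) : R) *: m) : gHom D N) (phi i)).
rewrite [f in RHS]dual_eE raddf_sum; apply: eq_bigr => i _.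
rewrite [v _]linearZ_LR; exact: esym (linearZ_LR (v m : gHom D N) _ (phi i)).
Qed.

End RightAdjoint.

Lemma dual_basis_coextension : has_right_adjoint (coextension h).
Proof.
apply: has_right_adjoint_universal => N.
exists (coind N), (mk_gmor (coind_eval_gmor N)) => M u; exact: coind_universal.
Qed.

(** * The left adjoint of the extension, the tensor product with [D] over [S] *)

Section LeftAdjoint.
Variable N : gradedMod S.

Definition ind : gradedMod R := grestr h (gtensor D N).

Lemma ind_scale_pure (r : R) f n :
  r *: (pure f n : ind) = pure (h r *: f : D) n :> ind.
Proof. by apply: tact_pure => a; exact: scale_linear. Qed.

(** The unit of the adjunction: the canonical element tensored with [n]. *)
Definition ind_unit (n : N) : gext h ind :=
  \sum_i pure (e i) (pure (phi i) n : ind).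

Lemma ind_unit_gmor : is_gmor ind_unit.
Proof.
have [pDl pDr pZ] := pure_balanced D N.
have [qDl qDr qZ] := pure_balanced P ind.
split=> [s n n'|g n cn].
  rewrite (_ : ind_unit (s *: n + n') = ind_unit (s *: n) + ind_unit n'); last first.
    by rewrite /ind_unit -big_split; apply: eq_bigr => i _ /=; rewrite -qDr -pDr.
  congr (_ + _); rewrite scaler_sumr.
  (* Centrality applied to [b] moves [s] from [e i] to [phi i]; [pZ] then carries it across the
     tensor product over [S] to [n]. *)
  pose b (t : P) (f : grestr h D) : gext h ind := pure t (pure (f : D) n : ind).
  have bb : balanced b.
    split=> [t t' x|t x x'|r t x]; rewrite /b; first exact: qDl.
    - by rewrite -qDr -pDl.
    - by rewrite qZ ind_scale_pure.
  transitivity (\sum_i b (smul s (e i)) (phi i)).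
    rewrite (dual_basis_central s bb); apply: eq_bigr => i _.
    by rewrite /b -pZ.
  by apply: eq_bigr => i _; rewrite ext_scale_pure.
apply: (hcomp_sum (@gtensor_comp0 _ _ P ind) (@gtensor_compB _ _ P ind)) => i _.
have cp : @gmod_comp _ _ ind (- d i + g) (pure (phi i) n).
  by apply: gtensor_comp_pure; [exact: cphi | exact: cn].
by have := gtensor_comp_pure (ce i) cp; rewrite addrA subrr add0r.
Qed.

Variable M : gradedMod R.

Definition contract_fun (f : D) (t : P) (m : M) : M := (f t : R) *: m.
(** The pairing of [D] with the extension of [M] that lets the latter act as Hom over [R] from [D]
    to [M]. *)
Definition contract (f : D) : gext h M -> M := tlift (contract_fun f).

Lemma contract_balanced f : balanced (contract_fun f).
Proof.
split=> [t t' m|t m m'|r t m]; rewrite /contract_fun.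
- by rewrite raddfD scalerDl.
- by rewrite scalerDr.
- by rewrite linearZ /= scalerA mulrC.
Qed.

Lemma contract_pure f t m : contract f (pure t m) = (f t : R) *: m.
Proof. exact: tlift_pure (contract_balanced f). Qed.

Lemma contractDr f : {morph contract f : x y / x + y}.
Proof. by move=> x y; exact: tliftD (contract_balanced f). Qed.

Lemma contract0r f : contract f 0 = 0.
Proof. by apply: (@addrI _ (contract f 0)); rewrite -contractDr !addr0. Qed.

Lemma contractDl f f' x : contract (f + f') x = contract f x + contract f' x.
Proof.
elim/tensor_ind: x => [|x y hx hy|t m]; first by rewrite !contract0r addr0.
  by rewrite !contractDr hx hy addrACA.
by rewrite !contract_pure -scalerDl.
Qed.

(** Both sides send [t (x) m] to [f(st) m]. This balance over [S] lets [ind_adj] be defined on the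
    tensor product over [S]. *)
Lemma contractZ (s : S) f x : contract (s *: f) x = contract f (s *: x).
Proof.
elim/tensor_ind: x => [|x y hx hy|t m]; first by rewrite scaler0 !contract0r.
  by rewrite scalerDr !contractDr hx hy.
by rewrite ext_scale_pure !contract_pure.
Qed.

Lemma contractZl (r : R) f x : contract (h r *: f) x = r *: contract f x.
Proof.
elim/tensor_ind: x => [|x y hx hy|t m]; first by rewrite !contract0r scaler0.
  by rewrite !contractDr hx hy scalerDr.
by rewrite !contract_pure -[(h r *: f) t]/(f (r *: t)) linearZ scalerA.
Qed.

Lemma contract_deg a b f x : gmod_comp a f -> gmod_comp b x ->
  gmod_comp (a + b) (contract f x).
Proof.
move=> cf [s [-> hs]]; rewrite (big_morph _ (contractDr f) (contract0r f)).
apply: (hcomp_sum (grading0 (gmod_grading M)) (gradingB (gmod_grading M))).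
move=> p /hs [c [c' [<- cc cc']]]; rewrite contract_pure addrA.
by apply: gmod_scale => //; exact: cf.2.
Qed.

(** Expand [t] in the dual basis and move the coefficients across the tensor sign. An element of the
    extension is thus determined by its contractions. *)
Lemma contract_sum (x : gext h M) : \sum_i pure (e i) (contract (phi i) x) = x.
Proof.
have [pDl pDr pZ] := pure_balanced P M.
have p0l m : pure (0 : P) m = 0 := balanced0l m (pure_balanced P M).
have p0r (t : P) : pure t (0 : M) = 0 by apply: (@addrI _ (pure t 0)); rewrite -pDr !addr0.
elim/tensor_ind: x => [|x y hx hy|t m].
- by rewrite big1 // => i _; rewrite contract0r p0r.
- rewrite -[in RHS]hx -[in RHS]hy -big_split; apply: eq_bigr => i _ /=.
  by rewrite contractDr pDr.
rewrite [t in RHS]eE (big_morph (fun t : P => pure t m) (fun x y => pDl x y m) (p0l m)).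
by apply: eq_bigr => i _; rewrite contract_pure pZ.
Qed.

Variable u : gmor N (gext h M).

Lemma ind_adj_balanced : balanced (fun (f : D) (n : N) => contract f (u n)).
Proof.
split=> [f f' n|f n n'|s f n]; first exact: contractDl.
- by rewrite raddfD contractDr.
- by rewrite contractZ linearZ.
Qed.

Definition ind_adj : ind -> M := tlift (fun (f : D) (n : N) => contract f (u n)).

Lemma ind_adj_gmor : is_gmor ind_adj.
Proof.
have aD x y : ind_adj (x + y) = ind_adj x + ind_adj y by exact: tliftD ind_adj_balanced.
have a0 : ind_adj 0 = 0 by apply: (@addrI _ (ind_adj 0)); rewrite -aD !addr0.
have ap f n : ind_adj (pure f n) = contract f (u n) by exact: tlift_pure ind_adj_balanced.
split=> [r x y|g x [s [-> hs]]].
  rewrite aD; congr (_ + _); elim/tensor_ind: x => [|x z hx hz|f n].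
  - by rewrite scaler0 a0 scaler0.
  - by rewrite scalerDr !aD hx hz scalerDr.
  by rewrite ind_scale_pure !ap contractZl.
rewrite (big_morph _ aD a0).
apply: (hcomp_sum (grading0 (gmod_grading M)) (gradingB (gmod_grading M))).
move=> p /hs [c [c' [<- cc cc']]]; rewrite ap; apply: contract_deg => //.
exact: (gmorP u).2.
Qed.

(** Existence is [contract_sum]. For uniqueness, contracting [u n] with [f] gives [v] at [pure f n],
    by the expansion of [f] in [dual_eE]. *)
Lemma ind_universal : exists! v : gmor ind M,
  u = gmor_comp (gext_map h v) (mk_gmor ind_unit_gmor).
Proof.
have mapE (v : gmor ind M) n :
    gext_map h v (ind_unit n) = \sum_i pure (e i) (v (pure (phi i) n)).
  exact: (gext_map_sum v _ (fun i => (e i, pure (phi i) n : ind))).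
exists (mk_gmor ind_adj_gmor); split.
  apply: gmorE => n; rewrite -[RHS]/(gext_map h _ (ind_unit n)) mapE -[LHS]contract_sum.
  apply: eq_bigr => i _; congr (pure _ _).
  exact/esym/tlift_pure/ind_adj_balanced.
move=> v uE; apply: gmorE; elim/tensor_ind => [|x y hx hy|f n].
- by rewrite !raddf0.
- by rewrite !raddfD; exact: congr2 hx hy.
rewrite [LHS](tlift_pure _ _ ind_adj_balanced).
have [pDl pDr pZ] := pure_balanced D N.
rewrite {1}uE -[gmor_comp _ _ n]/(gext_map h v (ind_unit n)) mapE.
rewrite (big_morph _ (contractDr f) (contract0r f)).
rewrite [f in RHS]dual_eE (big_morph (fun f : D => pure f n) (fun x y => pDl x y n) (balanced0l n (pure_balanced D N))).
rewrite [RHS]raddf_sum; apply: eq_bigr => i _ /=.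
by rewrite contract_pure -linearZ_LR ind_scale_pure.
Qed.

End LeftAdjoint.

Lemma dual_basis_extension : has_left_adjoint (extension h).
Proof.
apply: has_left_adjoint_universal => N.
exists (ind N), (mk_gmor (ind_unit_gmor N)) => M u; exact: ind_universal.
Qed.

End DualBasisAdjoints.

(** * Equivalence of the three conditions through dual bases *)

Theorem mainTheorem7 (G : zmodType) (R S : gradedRing G) (h : gringMor R S) :
  (has_left_adjoint (extension h) <-> has_right_adjoint (coextension h)) /\
  (has_right_adjoint (coextension h) <->
   projective (grestr_ring h) /\ finite_type (grestr_ring h)).
Proof.
have ra_db : has_right_adjoint (coextension h) -> has_dual_basis (grestr_ring h).
  move=> ra; apply/dual_basisP; split.
    exact: coextension_ra_projective.
  exact: coextension_ra_finite_type.
have db_ra : has_dual_basis (grestr_ring h) -> has_right_adjoint (coextension h).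
  by move=> [I [d [e [phi [ce cphi eE]]]]]; apply: (dual_basis_coextension ce cphi eE).
have db_la : has_dual_basis (grestr_ring h) -> has_left_adjoint (extension h).
  by move=> [I [d [e [phi [ce cphi eE]]]]]; apply: (dual_basis_extension ce cphi eE).
split; split.
- by move/extension_la_dual_basis/db_ra.
- by move/ra_db/db_la.
- by move/ra_db/dual_basisP.
- by move/dual_basisP/db_ra.
Qed.
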